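(* Let $n\ge 2$ and let $\Omega\subset\mathbb{R}^n$ be a bounded domain. Let $F=\ln\frac1f$ be a structured geometry. Let $\mathcal{L}u=\nabla^{\mathrm{tr}}\mathcal{A}(x,u(x))\nabla u$, where $\mathcal{A}$ has bounded measurable coefficients and $\mathcal{A}\approx D_f$. Suppose that $u\in W_f^{1,2}(\Omega)$ is a weak subsolution to $\mathcal{L}u=0$ in $\Omega$ and that $u$ is bounded in the weak sense on the boundary $\partial\Omega$. Then $$\sup_{\Omega}u\le\sup_{\partial\Omega}u .$$
   Context: **Structured geometry.** $f:\mathbb{R}\to[0,\infty)$ is even and continuous, $f(0)=0$, $f(t)>0$ for $t\ne0$, and for some $R>0$, $f=e^{-F}$ on $(0,R)$ with $F:(0,R)\to\mathbb{R}$ twice continuously differentiable. $F$ is a structured geometry if for some constants $C\ge1$, $\varepsilon>0$: (1) $\lim_{x\to0^+}F(x)=+\infty$; (2) $F'(x)<0$ and $F''(x)>0$ for all $x\in(0,R)$; (3) $\frac1C|F'(r)|\le|F'(x)|\le C|F'(r)|$ whenever $\frac12r<x<2r<R$; (4) $\frac{1}{-xF'(x)}$ is increasing on $(0,R)$ and $\frac1{-xF'(x)}\le\frac1\varepsilon$ there; (5) $\frac1{Cx}\le\frac{F''(x)}{-F'(x)}\le\frac Cx$ for $x\in(0,R)$. **Matrices.** For $x=(x_1,\dots,x_n)$, $D_f(x)$ is the $n\times n$ diagonal matrix with diagonal entries $1,\dots,1,f(x_1)^2$. $\mathcal{A}(x,z)$ ($x\in\Omega$, $z\in\mathbb{R}$)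 is a real symmetric nonnegative $n\times n$ matrix with bounded measurable entries (with $x\mapsto\mathcal{A}(x,u(x))$ measurable); $\mathcal{A}\approx D_f$ means there are constants $0<c\le C<\infty$ with $c\,\xi^{\mathrm{tr}}D_f(x)\xi\le\xi^{\mathrm{tr}}\mathcal{A}(x,z)\xi\le C\,\xi^{\mathrm{tr}}D_f(x)\xi$ for a.e. $x\in\Omega$ and all $z\in\mathbb{R}$, $\xi\in\mathbb{R}^n$. **Spaces.** $\nabla_fv=(\partial_{x_1}v,\dots,\partial_{x_{n-1}}v,f(x_1)\partial_{x_n}v)$, so $|\nabla_fv|^2=\nabla v^{\mathrm{tr}}D_f\nabla v$. $W_f^{1,2}(\Omega)$ is the space of $v\in L^2(\Omega)$ with $\nabla_fv\in L^2(\Omega)$ (weakly), with norm $\left(\int_\Omega(|v|^2+|\nabla_fv|^2)\right)^{1/2}$; $(W_f^{1,2})_0(\Omega)$ is the closure in it of the Lipschitz functions with compact support in $\Omega$. **Weak subsolutions.** $u\in W_f^{1,2}(\Omega)$ is a weak subsolution to $\mathcal{L}u=\phi$ if $-\int_\Omega(\nabla w)^{\mathrm{tr}}\mathcal{A}(x,u(x))\nabla u\,dx\ge\int_\Omega\phi w\,dx$ for all nonnegative $w\in(W_f^{1,2})_0(\Omega)$. **Boundary values.** $u\in W_f^{1,2}(\Omega)$ is bounded (in the weak sense) by $\ell\in\mathbb{R}$ on $\partial\Omega$ if $(u-\ell)^+=\max\{u-\ell,0\}\in(W_f^{1,2})_0(\Omega)$; $u$ is bounded in the weak sense on $\partial\Omega$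 if this holds for some $\ell$; and $\sup_{\partial\Omega}u=\inf\{\ell\in\mathbb{R}:(u-\ell)^+\in(W_f^{1,2})_0(\Omega)\}$. $\sup_\Omega$ is the essential supremum. *)

(* Defs.v *)
From HB Require Import structures.
From mathcomp Require Import all_boot all_order all_algebra.
From mathcomp Require Import all_classical all_reals all_analysis.
From mathcomp Require Import ess_sup_inf.

Set Implicit Arguments.
Unset Strict Implicit.
Unset Printing Implicit Defensive.

Import Order.TTheory GRing.Theory Num.Theory.
Import numFieldNormedType.Exports.

Local Open Scope classical_set_scope.
Local Open Scope ring_scope.

(* R^n is ['rV[R]_n], which the library equips with its norm and topology. It
   receives here the Borel sigma-algebra, generated by the coordinates as for
   [n.-tuple R], and the Lebesgue measure. *)
Section rV_measurable.
Context (R : realType) (n : nat).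

Definition rV_coord (i : 'I_n) (x : 'rV[R]_n) : measurableTypeR R := x 0 i.

Let rV_set0 : g_sigma_preimage rV_coord set0.
Proof. exact: sigma_algebra0. Qed.

Let rV_setC A : g_sigma_preimage rV_coord A -> g_sigma_preimage rV_coord (~` A).
Proof. exact: sigma_algebraC. Qed.

Let rV_bigcup (F : (set 'rV[R]_n)^nat) :
  (forall i, g_sigma_preimage rV_coord (F i)) ->
  g_sigma_preimage rV_coord (\bigcup_i (F i)).
Proof. exact: sigma_algebra_bigcup. Qed.

HB.instance Definition _ := @isMeasurable.Build default_measure_display
  'rV[R]_n (g_sigma_preimage rV_coord) rV_set0 rV_setC rV_bigcup.

Lemma measurable_rV_coord i : measurable_fun [set: 'rV[R]_n] (rV_coord i).
Proof.
move=> _ Y mY; rewrite setTI; apply: sub_sigma_algebra => /=.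
rewrite -bigcup_seq/=; exists i => /=; first by rewrite mem_index_enum.
by exists Y => //; rewrite setTI.
Qed.

Lemma measurable_fun_rVP d (T : measurableType d) (f : T -> 'rV[R]_n) :
  (forall i, measurable_fun [set: T] (rV_coord i \o f)) ->
  measurable_fun [set: T] f.
Proof.
move=> mf.
suff H : g_sigma_preimage rV_coord `<=`
    [set A | measurable (f @^-1` A)].
  by move=> _ A /H /=; rewrite setTI.
apply: smallest_sub.
  split => /=; first by rewrite preimage_set0.
  - by move=> A mA; rewrite setTD -preimage_setC; exact: measurableC.
  - by move=> F mF; rewrite preimage_bigcup; exact: bigcup_measurable.
move=> A; rewrite -bigcup_seq/= => -[i _ [B mB <-]] /=.
by rewrite setTI -comp_preimage -[X in measurable X]setTI; exact: mf.
Qed.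

End rV_measurable.

Section rV_lebesgue.
Context (R : realType).

Definition rV_cons n (p : measurableTypeR R * 'rV[R]_n) : 'rV[R]_n.+1 :=
  \row_i oapp (fun j => p.2 0 j) p.1 (unlift ord0 i).

Lemma measurable_rV_cons n : measurable_fun setT (@rV_cons n).
Proof.
apply: measurable_fun_rVP => i; rewrite /rV_coord /comp/= /rV_cons.
case: (unliftP ord0 i) => [j ->|->].
  under eq_fun do rewrite mxE liftK /=.
  exact: (measurableT_comp (measurable_rV_coord j) measurable_snd).
under eq_fun do rewrite mxE unlift_none /=.
exact: measurable_fst.
Qed.

Definition rV_uncons n (x : 'rV[R]_n.+1) : measurableTypeR R * 'rV[R]_n :=
  (x 0 ord0, \row_j x 0 (lift ord0 j)).

Lemma rV_consK n : cancel (@rV_cons n) (@rV_uncons n).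
Proof.
case=> t y; rewrite /rV_uncons /rV_cons mxE unlift_none; congr pair.
by apply/rowP => j; rewrite !mxE liftK.
Qed.

Lemma measurable_rV_uncons n : measurable_fun setT (@rV_uncons n).
Proof.
apply/measurable_fun_pairP; split; first exact: measurable_rV_coord.
apply: measurable_fun_rVP => i.
rewrite /rV_coord /comp/=; under eq_fun do rewrite mxE.
exact: (measurable_rV_coord (lift ord0 i)).
Qed.

Section step.
Context (n : nat) (m : {sigma_finite_measure set 'rV[R]_n -> \bar R}).

Definition rV_cons_measure : set 'rV[R]_n.+1 -> \bar R :=
  pushforward (@lebesgue_measure R \x m)%E (@rV_cons n).

Let mP := @measurable_rV_cons n.

Let rV_cons_measure0 : rV_cons_measure set0 = 0%E.
Proof. by rewrite /rV_cons_measure /pushforward preimage_set0 measure0. Qed.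

Let rV_cons_measure_ge0 A : (0 <= rV_cons_measure A)%E.
Proof. exact: measure_ge0. Qed.

Let rV_cons_measure_sigma_additive : semi_sigma_additive rV_cons_measure.
Proof. exact: (@measure_semi_sigma_additive _ _ _ (pushforward _ _)). Qed.

HB.instance Definition _ := isMeasure.Build _ _ _ rV_cons_measure
  rV_cons_measure0 rV_cons_measure_ge0 rV_cons_measure_sigma_additive.

Let rV_cons_measure_sigma_finite : sigma_finite setT rV_cons_measure.
Proof.
have /sigma_finiteP[G [TG ndG Goo]] := sigma_finiteT m.
have /sigma_finiteP[F [TF ndF Foo]] := sigma_finiteT (@lebesgue_measure R).
exists (fun k => @rV_uncons n @^-1` (F k `*` G k)).
  apply/esym; rewrite -subTset => x _.
  have [i _ Fi] : (\bigcup_k F k) (x 0 ord0) by rewrite -TF.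
  have [j _ Gj] : (\bigcup_k G k) (\row_j x 0 (lift ord0 j)) by rewrite -TG.
  exists (maxn i j) => //; split => /=.
    by move: Fi; exact/subsetPset/ndF/leq_maxl.
  by move: Gj; exact/subsetPset/ndG/leq_maxr.
move=> k; have [mF Fk] := Foo k; have [mG Gk] := Goo k.
have mFG : measurable (F k `*` G k) by exact: measurableX.
split; first by rewrite -[X in measurable X]setTI; exact: measurable_rV_uncons.
rewrite /rV_cons_measure /pushforward -comp_preimage.
rewrite (_ : @rV_uncons n \o @rV_cons n = id); last first.
  by apply/funext => p; exact: rV_consK.
by rewrite preimage_id product_measure1E// lte_mul_pinfty// ge0_fin_numE.
Qed.

HB.instance Definition _ := Measure_isSigmaFinite.Build _ _ _ rV_cons_measure
  rV_cons_measure_sigma_finite.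

End step.

Fixpoint lebesgue_rV n : {sigma_finite_measure set 'rV[R]_n -> \bar R} :=
  if n is m.+1 then rV_cons_measure (lebesgue_rV m) else \d_(0 : 'rV[R]_0).

Lemma lebesgue_rV_box n (A : 'I_n -> set (measurableTypeR R)) :
  (forall i, measurable (A i)) ->
  lebesgue_rV n [set x | forall i, A i (x 0 i)] =
    (\prod_(i < n) lebesgue_measure (A i))%E.
Proof.
elim: n A => [|n IHn] A mA.
  rewrite big_ord0 -[RHS](diracT R (0 : 'rV[R]_0)); congr (\d_ _ _).
  by apply/seteqP; split => // x _ [].
have mB : measurable [set x : 'rV[R]_n | forall i, A (lift ord0 i) (x 0 i)].
  rewrite (_ : [set _ | _] =
    \big[setI/setT]_(i < n) (rV_coord i @^-1` A (lift ord0 i))).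
    apply: bigsetI_measurable => i _; rewrite -[X in measurable X]setTI.
    exact: measurable_rV_coord.
  rewrite -bigcap_seq; apply/seteqP; split => x /= Ax i => [_|].
    exact: Ax.
  by apply: Ax; rewrite /= mem_index_enum.
rewrite big_ord_recl -IHn// /= /rV_cons_measure /pushforward.
rewrite -product_measure1E//; congr ((_ \x _)%E _).
apply/seteqP; split => [[t y] /= Aty|[t y] /= [At Ay] i].
  split; first by have := Aty ord0; rewrite mxE unlift_none.
  by move=> i; have := Aty (lift ord0 i); rewrite mxE liftK.
rewrite mxE; case: (unliftP ord0 i) => [j ->|->] //=; exact: Ay.
Qed.

End rV_lebesgue.

Section geometry.
Context (R : realType).

Definition degeneracy (f : R -> R) : Prop :=
  [/\ continuous f, forall t, 0 <= f t, forall t, f (- t) = f t, f 0 = 0 &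
      forall t, t != 0 -> 0 < f t].

(* "Increasing" in the fourth condition on [F] is taken in the wide sense. *)
Definition structured_geometry (r0 : R) (F : R -> R) : Prop :=
  let F' := F^`()%classic in let F'' := F^`(2)%classic in
  {in `]0, r0[, forall x : R,
    [/\ derivable F x 1, derivable F' x 1 & {for x, continuous F''}]} /\
  exists C eps : R, 1 <= C /\ 0 < eps /\
  [/\ F x @[x --> 0^'+] --> +oo,
      {in `]0, r0[, forall x, F' x < 0 /\ 0 < F'' x},
      forall r x : R, r / 2 < x -> x < 2 * r -> 2 * r < r0 ->
        C^-1 * `|F' r| <= `|F' x| <= C * `|F' r|,
      {in `]0, r0[ &, {homo (fun x => 1 / - (x * F' x)) : x y / x <= y}} /\
      {in `]0, r0[, forall x, 1 / - (x * F' x) <= 1 / eps} &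
      {in `]0, r0[, forall x,
        1 / (C * x) <= F'' x / - F' x <= C / x}].

End geometry.

Section sobolev.
Context (R : realType) (n : nat).
Local Notation mu := (lebesgue_rV R n.+1).
Implicit Types (f : R -> R) (Omega : set 'rV[R]_n.+1) (v w : 'rV[R]_n.+1 -> R).
Implicit Types (G : 'rV[R]_n.+1 -> 'rV[R]_n.+1).

(* Measurability for the completed measure. The integrals below only depend on
   the almost everywhere class of the integrand. *)
Definition lebesgue_measurable Omega v : Prop :=
  exists2 h, measurable_fun Omega h & v = h %[ae mu in Omega].

Definition L2 Omega v : Prop :=
  lebesgue_measurable Omega v /\
  (\int[mu]_(x in Omega) ((v x) ^+ 2)%:E < +oo)%E.

Definition compact_support_in Omega v : Prop :=
  compact (closure [set x | v x != 0]) /\ closure [set x | v x != 0] `<=` Omega.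

Definition partial (i : 'I_n.+1) v : 'rV[R]_n.+1 -> R :=
  'D_(delta_mx ord0 i) v.

Definition smooth v : Prop := forall s : seq 'I_n.+1,
  continuous (foldr partial v s) /\
  forall i x, derivable (foldr partial v s) x (delta_mx ord0 i).

Definition test_function Omega v : Prop :=
  smooth v /\ compact_support_in Omega v.

(* The coordinates [x_1] and [x_n] have indices [ord0] and [ord_max]. *)
Definition weight f (x : 'rV[R]_n.+1) (i : 'I_n.+1) : R :=
  if i == ord_max then f (x ord0 ord0) else 1.

Definition Dmat f (x : 'rV[R]_n.+1) : 'M[R]_n.+1 :=
  diag_mx (\row_i if i == ord_max then f (x ord0 ord0) ^+ 2 else 1).

(* [G] is the weak gradient [\nabla_f v]. As [f] only depends on [x_1], the
   vector fields [d/dx_1, ..., d/dx_(n-1), f(x_1) d/dx_n] are skew-adjoint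
   (when the dimension is at least 2), so that no derivative of [f] appears. *)
Definition weak_gradf f Omega v G : Prop :=
  forall (i : 'I_n.+1) phi, test_function Omega phi ->
    \int[mu]_(x in Omega) (v x * (weight f x i * partial i phi x)) =
    - (\int[mu]_(x in Omega) (G x ord0 i * phi x)).

Definition Wf_gradient f Omega v G : Prop :=
  [/\ L2 Omega v, forall i, L2 Omega (fun x => G x ord0 i) &
      weak_gradf f Omega v G].

Definition Wf f Omega v : Prop := exists G, Wf_gradient f Omega v G.

Definition Wf_norm Omega v G : R :=
  Num.sqrt (\int[mu]_(x in Omega)
    (`|v x| ^+ 2 + \sum_(i < n.+1) G x ord0 i ^+ 2)).

Definition Wf0 f Omega w : Prop :=
  Wf f Omega w /\
  forall eps : R, 0 < eps -> exists phi : 'rV[R]_n.+1 -> R,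
    [/\ lipschitz phi, compact_support_in Omega phi &
        exists2 G, Wf_gradient f Omega (w \- phi) G &
                   Wf_norm Omega (w \- phi) G < eps].

(* Recovers [\nabla v] from [\nabla_f v] off the null set [x_1 = 0]. *)
Definition full_gradient f G (x : 'rV[R]_n.+1) : 'rV[R]_n.+1 :=
  \row_i (G x ord0 i / weight f x i).

Definition mxform (M : 'M[R]_n.+1) (xi eta : 'rV[R]_n.+1) : R :=
  (xi *m M *m eta^T) ord0 ord0.

Section equation.
Context (A : 'rV[R]_n.+1 -> R -> 'M[R]_n.+1).

Definition admissible_coefficients Omega (u : 'rV[R]_n.+1 -> R) : Prop :=
  [/\ forall x z, Omega x -> (A x z)^T = A x z,
      forall x z xi, Omega x -> 0 <= mxform (A x z) xi xi,
      exists M : R, forall x z i j, Omega x -> `|A x z i j| <= M,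
      forall z i j, lebesgue_measurable Omega (fun x => A x z i j) &
      forall i j, lebesgue_measurable Omega (fun x => A x (u x) i j)].

Definition comparable_Dmat f Omega : Prop :=
  exists c C : R, [/\ 0 < c, c <= C &
    {ae mu, forall x, Omega x -> forall z xi,
      c * mxform (Dmat f x) xi xi <= mxform (A x z) xi xi
        <= C * mxform (Dmat f x) xi xi}].

Definition weak_subsolution f Omega (phi u : 'rV[R]_n.+1 -> R) : Prop :=
  Wf f Omega u /\
  forall Gu w Gw, Wf_gradient f Omega u Gu ->
    Wf0 f Omega w -> Wf_gradient f Omega w Gw ->
    {ae mu, forall x, Omega x -> 0 <= w x} ->
    \int[mu]_(x in Omega) (phi x * w x) <=
    - (\int[mu]_(x in Omega)
         mxform (A x (u x)) (full_gradient f Gw x) (full_gradient f Gu x)).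

End equation.

Definition boundary_bounded_by f Omega (u : 'rV[R]_n.+1 -> R) (l : R) : Prop :=
  Wf0 f Omega (fun x => Num.max (u x - l) 0).

Definition boundary_sup f Omega (u : 'rV[R]_n.+1 -> R) : \bar R :=
  ereal_inf [set l%:E | l in boundary_bounded_by f Omega u].

Definition ess_sup_in Omega (u : 'rV[R]_n.+1 -> R) : \bar R :=
  ess_sup mu (patch (fun=> -oo%E) Omega (EFin \o u)).

End sobolev.

(* Main.v *)
Require Import Defs.
From mathcomp Require Import all_boot all_order all_algebra.
From mathcomp Require Import all_classical all_reals all_analysis.
From mathcomp Require Import measurable_realfun ess_sup_inf.
From mathcomp Require Import ring lra.
Import Order.TTheory GRing.Theory Num.Theory.
Import numFieldNormedType.Exports.
Local Open Scope classical_set_scope.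
Local Open Scope ring_scope.

(** Fix a bound [l] for [u] on the boundary and put [w = (u - l)^+]. The
    function [w] is an admissible nonnegative test function, and its degenerate
    gradient is that of [u] where [u > l] and zero elsewhere. Testing the
    inequality for subsolutions with [w] thus gives
      0 <= - int A(x, u) grad w . grad w <= - c int |grad_f w|^2,
    so that the gradient of [w] vanishes. As the first direction is not
    degenerate in dimension at least two and [w] has zero boundary values, the
    Poincare inequality in that direction forces [w = 0], that is, [u <= l]
    almost everywhere. Letting [l] decrease to the supremum of [u] on the
    boundary concludes.

    Two facts on Sobolev functions carry the argument: the formula for the
    gradient of a positive part ([positive_part_gradient]) and the Poincare
    inequality ([poincare_lipschitz], [Wf0_eq0]). Both are derived from a
    description of weak derivatives by difference quotients
    ([weak_quotient_cvg], [Wf_quotient_cvg]): almost everywhere, the quotients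
    (W(x + h e_i) - W(x)) / h along h = 1/(k+1) and along h = -1/(k+1) converge
    to the weak derivative. The weight of the i-th derivative does not depend
    on the i-th coordinate, hence factors out of the quotients.

    - At a point where [u = l], the quotients of [w] are nonnegative for h > 0
      and nonpositive for h < 0, so that their common limit is zero; where
      [u <> l] the quotients of [w] eventually agree with those of [u] or
      vanish.

    - For a Lipschitz function [phi] with compact support the quotients are
      bounded, and the translation invariance of
      int x_1 phi^2 gives int phi^2 = - 2 int x_1 phi (d phi / dx_1) in the limit.

    The convergence of the quotients is obtained as follows. Testing the
    definition of the weak derivative [G] of [W] with integrals of smooth
    product bumps over short segments, Fubini's theorem and translation
    invariance show that the defect
      W(x + h d) - W(x) - int_0^h G(x + t d) dt
    has integral zero against every bump ([difference_defect_bump]). The bumps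
    are built from exp(-1/t), and exp(-1/(m t)) tends boundedly to the
    indicator of t > 0, so that the defect has integral zero over every box and
    vanishes almost everywhere ([difference_identity_local]). The
    one-dimensional Lebesgue differentiation theorem on almost every line,
    transported by Fubini's theorem and translations, identifies the limit of
    the averages of [G] over segments ([segint_cvg]). *)

Set Implicit Arguments.
Unset Strict Implicit.
Unset Printing Implicit Defensive.

(** * The Borel structure of the space of row vectors *)

Section lebesgue_rV_basics.
Context (R : realType) (n : nat).
Local Notation mu := (lebesgue_rV R n).
Implicit Types (x y v : 'rV[R]_n).

Lemma measurable_rV_box (A : 'I_n -> set (measurableTypeR R)) :
  (forall i, measurable (A i)) ->
  measurable [set x : 'rV[R]_n | forall i, A i (x 0 i)].
Proof.
move=> mA.
rewrite (_ : [set _ | _] = \big[setI/setT]_(i < n) (rV_coord i @^-1` A i)).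
  apply: bigsetI_measurable => i _; rewrite -[X in measurable X]setTI.
  exact: measurable_rV_coord.
rewrite -bigcap_seq; apply/seteqP; split => x /= Ax i => [_|].
  exact: Ax.
by apply: Ax; rewrite /= mem_index_enum.
Qed.

Lemma rV_coord_le_norm x i : `|x 0 i| <= `|x|.
Proof.
rewrite [leRHS]/Num.norm /= mx_normrE; apply/bigmax_geP; right => /=.
by exists (0, i).
Qed.

Lemma measurable_rV_ball x (r : R) : measurable (ball x r).
Proof.
have [r0|r0] := ltP 0 r; last first.
  rewrite (_ : ball x r = set0); first exact: measurable0.
  by apply/seteqP; split => // y /= [r0' _]; move: r0'; rewrite ltNge r0.
rewrite (_ : ball x r = [set y | forall i, ball (x 0 i) r (y 0 i)]).
  apply: (@measurable_rV_box (fun i => ball (x 0 i) r)) => i.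
  exact: measurable_ball.
apply/seteqP; split => y /=.
  by move=> [_ xy] i; exact: xy.
by move=> xy; split => // i j; rewrite (ord1 i).
Qed.

(** A point with rational coordinates. *)
Definition rat_point (q : 'rV[rat]_n) : 'rV[R]_n := map_mx ratr q.

(** Balls with rational centers and radii form a countable base. *)
Definition rat_ball (q : 'rV[rat]_n * nat) : set 'rV[R]_n :=
  ball (rat_point q.1) (q.2.+1%:R^-1).

(** Every point of an open set [O] lies in a rational ball whose dilation by
    the factor [s] is still contained in [O]. *)
Lemma rat_ball_nbhs (O : set 'rV[R]_n) x (s : R) : 1 <= s -> open O -> O x ->
  exists2 q, rat_ball q x &
    ball (rat_point q.1) (s * q.2.+1%:R^-1) `<=` O.
Proof.
move=> s1 oO Ox.
have /nbhs_ballP[e /= e0 xO] : nbhs x O by exact: open_nbhs_nbhs.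
have [k ke] : exists k : nat, (1 + s) * k.+1%:R^-1 < e.
  exists (Num.truncn ((1 + s) / e)).
  rewrite ltr_pdivrMr ?ltr0n// mulrC -ltr_pdivrMr//.
  exact: truncnS_gt.
have q_ i : exists q : rat, ball (x 0 i) (k.+1%:R^-1) (ratr q).
  have [] := @dense_rat R (ball (x 0 i) (k.+1%:R^-1)).
  - by exists (x 0 i); apply: ballxx; rewrite invr_gt0 ltr0n.
  - exact: ball_open.
  by move=> y [xy [q _ qy]]; exists q; rewrite qy.
have k0 : 0 < k.+1%:R^-1 :> R by rewrite invr_gt0 ltr0n.
have /choice[q xq] := q_.
have xb : ball (rat_point (\row_i q i)) (k.+1%:R^-1) x.
  split => // a i; rewrite (ord1 a) !mxE; apply: ball_sym; exact: xq.
exists (\row_i q i, k) => // y /=.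
move=> qy; apply: xO; have := ball_triangle (ball_sym xb) qy.
apply: le_ball; apply/ltW; apply: le_lt_trans ke.
by rewrite mulrDl mul1r.
Qed.

Lemma open_measurable_rV (O : set 'rV[R]_n) : open O -> measurable O.
Proof.
move=> oO; pose B q := if `[<rat_ball q `<=` O>] then rat_ball q else set0.
rewrite (_ : O = \bigcup_q B q).
  apply: countable_bigcupT_measurable; first exact: countableP.
  move=> q; rewrite /B; case: asboolP => _; last exact: measurable0.
  exact: measurable_rV_ball.
apply/seteqP; split => [x Ox|x [q _]]; last first.
  by rewrite /B; case: asboolP => // + ?; exact.
have [q qx] := rat_ball_nbhs (lexx 1) oO Ox.
by rewrite mul1r => qO; exists q => //; rewrite /B; case: asboolP.
Qed.

Lemma continuous_measurable_rV (g : 'rV[R]_n -> R) :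
  continuous g -> measurable_fun setT g.
Proof.
move=> /continuousP cg.
apply: (measurability _ (RGenOpens.measurableE R)).
move=> _ [_ [a [b ->] <-]]; rewrite setTI.
by apply: open_measurable_rV; apply: cg; exact: interval_open.
Qed.

Lemma measurable_translation v : measurable_fun setT (fun x => x + v).
Proof.
apply: measurable_fun_rVP => i; rewrite /rV_coord /comp/=.
under eq_fun do rewrite mxE.
by apply: measurable_funD => //; exact: measurable_rV_coord.
Qed.

End lebesgue_rV_basics.

(** * Translation invariance of the Lebesgue measure *)

Section translation_invariance.
Context (R : realType).

Lemma lebesgue_measureD (c : R) (A : set (measurableTypeR R)) : measurable A ->
  lebesgue_measure [set t : R | A (t + c)] = lebesgue_measure A.
Proof.
move=> mA.
have mD : measurable_fun setT
    ((fun t => t + c) : measurableTypeR R -> measurableTypeR R).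
  exact: measurable_funD.
rewrite [RHS](lebesgue_measure_unique
  (mu := pushforward lebesgue_measure
     ((fun t => t + c) : measurableTypeR R -> measurableTypeR R)))//.
move=> _ [[a b] _ <-]; rewrite /pushforward/=.
transitivity (lebesgue_measure (`]a - c, b - c]%classic : set R)); last first.
  congr lebesgue_measure.
  by apply/seteqP; split => t /=; rewrite !in_itv/= ltrBlDr lerBrDr.
rewrite !lebesgue_measure_itv/= !lte_fin ltrD2r; case: ifPn => // _.
by rewrite -!EFinB opprD opprK addrACA addNr addr0.
Qed.

Context (n : nat).
Local Notation mu := (lebesgue_rV R n).
Implicit Types (x y v : 'rV[R]_n).

(** The measurable boxes form a pi-system which generates the Borel
    sigma-algebra. *)
Definition rV_boxes : set (set 'rV[R]_n) :=
  [set [set x : 'rV[R]_n | forall i, A i (x 0 i)] |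
    A in [set A : 'I_n -> set (measurableTypeR R) | forall i, measurable (A i)]].

Lemma measurable_rV_boxes : @measurable _ 'rV[R]_n = <<s rV_boxes >>.
Proof.
apply/seteqP; split; apply: smallest_sub.
- exact: smallest_sigma_algebra.
- move=> A; rewrite -bigcup_seq/= => -[i _ [B mB <-]] /=; rewrite setTI.
  apply: sub_sigma_algebra; exists (fun j => if j == i then B else setT).
    by move=> j; case: ifP.
  apply/seteqP; split => x /=; rewrite /rV_coord.
    by move/(_ i); rewrite eqxx.
  by move=> Bx j; case: eqP => // ->.
- exact: sigma_algebra_measurable.
- by move=> _ [A mA <-]; exact: measurable_rV_box.
Qed.

Lemma setI_closed_rV_boxes : setI_closed rV_boxes.
Proof.
move=> _ _ [A mA <-] [B mB <-]; exists (fun i => A i `&` B i).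
  by move=> i; exact: measurableI.
by apply/seteqP; split=> x /= => [ABx|[Ax Bx] i]; [split => i; have [] := ABx i|].
Qed.

(** A measure which gives every measurable box the product of the lengths of
    its sides is the Lebesgue measure. *)
Lemma lebesgue_rV_unique (m : {measure set 'rV[R]_n -> \bar R}) :
  (forall A : 'I_n -> set (measurableTypeR R), (forall i, measurable (A i)) ->
    m [set x : 'rV[R]_n | forall i, A i (x 0 i)] =
      (\prod_(i < n) lebesgue_measure (A i))%E) ->
  forall A, measurable A -> m A = mu A.
Proof.
move=> mE A mA; apply/esym.
pose g (k : nat) := [set x : 'rV[R]_n | forall i : 'I_n, `]-k%:R, k%:R[%classic (x 0 i)].
apply: (measure_unique rV_boxes g) => //.
- exact: measurable_rV_boxes.
- exact: setI_closed_rV_boxes.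
- by move=> k; exists (fun=> `]-k%:R, k%:R[%classic) => // i; exact: measurable_itv.
- apply/seteqP; split => // x _; exists (Num.truncn `|x|).+1 => // i /=.
  rewrite in_itv/= -ltr_norml; apply: le_lt_trans (truncnS_gt _).
  exact: rV_coord_le_norm.
- by move=> _ [B mB <-]; rewrite mE//; exact: lebesgue_rV_box.
- move=> k.
  rewrite [X in (X < _)%E](_ : _ = \prod_(i < n)
      lebesgue_measure (`](- k%:R)%R, (k%:R)%R[%classic : set (measurableTypeR R)))%E; last first.
    apply: (lebesgue_rV_box (A := fun=> `](- k%:R : R), (k%:R : R)[%classic)) => i.
    exact: measurable_itv.
  suff /fin_numPlt/andP[] : (\prod_(i < n)
      lebesgue_measure (`](- k%:R)%R, (k%:R)%R[%classic : set (measurableTypeR R)))%E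
    \is a fin_num by [].
  elim/big_ind : _ => // [a b|i _]; first exact: fin_numM.
  by rewrite lebesgue_measure_itv/=; case: ifPn.
Qed.

Lemma lebesgue_rV_translation v (A : set 'rV[R]_n) : measurable A ->
  mu [set x | A (x + v)] = mu A.
Proof.
move=> mA; rewrite -[RHS](@lebesgue_rV_unique (pushforward mu (fun x => x + v)))//.
  exact: measurable_translation.
move=> mt B mB; rewrite /= /pushforward.
transitivity (mu [set x | forall i, [set t | B i (t + v 0 i)] (x 0 i)]).
  by congr (mu _); apply/seteqP; split => x /= Bx i; have := Bx i; rewrite mxE.
have mBv i : measurable
    ([set t | B i (t + v 0 i)] : set (measurableTypeR R)).
  have mD : measurable_fun setT
      ((fun t => t + v 0 i) : measurableTypeR R -> measurableTypeR R).
    exact: measurable_funD.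
  by rewrite -[X in measurable X]setTI; exact: mD.
transitivity (\prod_(i < n)
    lebesgue_measure ([set t | B i (t + v 0 i)%R] : set (measurableTypeR R)))%E.
  exact: (lebesgue_rV_box mBv).
by apply: eq_bigr => i _; rewrite lebesgue_measureD.
Qed.

Lemma negligible_translation v (N : set 'rV[R]_n) : mu.-negligible N ->
  mu.-negligible [set x | N (x + v)].
Proof.
move=> [A [mA A0 NA]]; exists [set x | A (x + v)]; split.
- rewrite -[X in measurable X]setTI; exact: measurable_translation.
- by rewrite lebesgue_rV_translation.
- by move=> x /NA.
Qed.

Lemma ae_translation v (P : set 'rV[R]_n) : {ae mu, forall x, P x} ->
  {ae mu, forall x, P (x + v)}.
Proof. exact: negligible_translation. Qed.

Let pushE v A : measurable A -> A `<=` setT ->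
  mu A = pushforward mu (fun x => x + v) A.
Proof. by move=> mA _; rewrite /pushforward lebesgue_rV_translation. Qed.

Lemma ge0_integral_translation v (g : 'rV[R]_n -> \bar R) :
  measurable_fun setT g -> (forall x, 0 <= g x)%E ->
  (\int[mu]_x g (x + v)%R = \int[mu]_x g x)%E.
Proof.
move=> mg g0; have mv := @measurable_translation R n v.
transitivity (\int[pushforward mu (fun x => (x + v)%R)]_x g x)%E.
  by rewrite ge0_integral_pushforward.
by apply: eq_measure_integral => A mA AT; exact/esym/(@pushE v).
Qed.

Lemma integrable_translation v (g : 'rV[R]_n -> \bar R) :
  mu.-integrable setT g -> mu.-integrable setT (fun x => g (x + v)).
Proof.
move=> /integrableP[mg goo]; apply/integrableP; split.
  by apply: measurableT_comp => //; exact: measurable_translation.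
rewrite (ge0_integral_translation v (g := fun x => `|g x|%E))//.
exact: measurableT_comp.
Qed.

Lemma integral_translation v (g : 'rV[R]_n -> \bar R) :
  mu.-integrable setT g ->
  (\int[mu]_x g (x + v)%R = \int[mu]_x g x)%E.
Proof.
move=> ig; have mv := @measurable_translation R n v.
transitivity (\int[pushforward mu (fun x => (x + v)%R)]_x g x)%E.
  rewrite integral_pushforward//; first exact: measurable_int ig.
  exact: integrable_translation.
by apply: eq_measure_integral => A mA AT; exact/esym/(@pushE v).
Qed.

End translation_invariance.

(** * Integrals up to null sets, and integrals over orthants *)

Section almost_everywhere_integral.
Context d (T : measurableType d) (R : realType).
Variable mu : {measure set T -> \bar R}.
Local Open Scope ereal_scope.

Lemma negligible_bigcup_countable (I : countType) (F : I -> set T) :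
  (forall i, mu.-negligible (F i)) -> mu.-negligible (\bigcup_i F i).
Proof.
move=> F0; pose G k := if unpickle k is Some i then F i else set0.
apply: (@negligibleS _ _ _ _ (\bigcup_k G k)).
  by move=> t [i _ Ft]; exists (pickle i) => //; rewrite /G pickleK.
apply: negligible_bigcup => k; rewrite /G.
by case: unpickle => // ; exact: negligible_set0.
Qed.

Import HBNNSimple.

(** The integral of a nonnegative function is a lower integral, so that no
    measurability is needed for it to be monotone. *)
Lemma ge0_le_integral_ae (D : set T) (f g : T -> \bar R) :
  (forall x, D x -> 0 <= f x) -> (forall x, D x -> 0 <= g x) ->
  {ae mu, forall x, D x -> f x <= g x} ->
  \int[mu]_(x in D) f x <= \int[mu]_(x in D) g x.
Proof.
move=> f0 g0 [N [mN N0 fgN]].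
rewrite integral_mkcond [leRHS]integral_mkcond.
have fD0 x : 0 <= (f \_ D) x by rewrite patchE; case: ifPn => // /set_mem/f0.
have gD0 x : 0 <= (g \_ D) x by rewrite patchE; case: ifPn => // /set_mem/g0.
(* A simple function below [f], once set to zero on the exceptional null set,
   is below [g] and keeps its integral. *)
rewrite !ge0_integralTE//; apply: ge_ereal_sup => _ [h hf <-].
apply: ereal_sup_ubound; exists (proj_nnsfun h (measurableC mN)).
  move=> x /=; rewrite mindicE; have [xN|xN] := boolP (x \in ~` N); last first.
    by rewrite mulr0.
  rewrite mulr1; apply: (le_trans (hf x)); rewrite !patchE.
  case: ifPn => // /set_mem Dx; have := xN; rewrite inE/=.
  by apply: contra_notP => fg; apply: fgN => /= /(_ Dx).
rewrite -!integralT_nnsfun; apply: ae_eq_integral => //.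
  exact/measurable_EFinP.
  exact/measurable_EFinP.
exists N; split => // x /=; apply: contra_notP => xN _; rewrite mindicE.
by rewrite mem_set// mulr1.
Qed.

Lemma ge0_eq_integral_ae (D : set T) (f g : T -> \bar R) :
  (forall x, D x -> 0 <= f x) -> (forall x, D x -> 0 <= g x) ->
  {ae mu, forall x, D x -> f x = g x} ->
  \int[mu]_(x in D) f x = \int[mu]_(x in D) g x.
Proof.
move=> f0 g0 fg; apply/eqP; rewrite eq_le; apply/andP.
split; apply: ge0_le_integral_ae => //; apply: filterS fg => x + Dx => ->//.
Qed.

Lemma eq_integral_ae (D : set T) (f g : T -> \bar R) :
  {ae mu, forall x, D x -> f x = g x} ->
  \int[mu]_(x in D) f x = \int[mu]_(x in D) g x.
Proof.
move=> fg; rewrite integralE [RHS]integralE; congr (_ - _);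
  apply: ge0_eq_integral_ae => //; apply: filterS fg => x + Dx => /(_ Dx).
- by rewrite !funeposE => ->.
- by rewrite !funenegE => ->.
Qed.

Lemma eq_Rintegral_ae (D : set T) (f g : T -> R) :
  {ae mu, forall x, D x -> f x = g x} ->
  (\int[mu]_(x in D) f x = \int[mu]_(x in D) g x)%R.
Proof.
move=> fg; rewrite /Rintegral; congr fine; apply: eq_integral_ae.
by apply: filterS fg => x /[apply] ->.
Qed.

End almost_everywhere_integral.

Section orthants.
Context (R : realType) (n : nat).
Local Notation mu := (lebesgue_rV R n).
Implicit Types (x y a : 'rV[R]_n).

(** The open orthant of the points whose coordinates all exceed those of
    [a]. *)
Definition orthant a : set 'rV[R]_n := [set x | forall i, a 0 i < x 0 i].

Lemma measurable_orthant a : measurable (orthant a).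
Proof.
rewrite (_ : orthant a =
    [set x | forall i, (`]a 0 i, +oo[%classic : set R) (x 0 i)]).
  apply: (@measurable_rV_box R n (fun i => `]a 0 i, +oo[%classic)) => i.
  exact: measurable_itv.
by apply/seteqP; split => x /= ax i; have := ax i; rewrite in_itv/= andbT.
Qed.

Lemma setI_closed_orthant : setI_closed (range orthant).
Proof.
move=> _ _ [a _ <-] [b _ <-]; exists (\row_i Num.max (a 0 i) (b 0 i)) => //.
apply/seteqP; split => x /= => [abx|[ax bx] i].
  by split => i; have := abx i; rewrite mxE gt_max => /andP[].
by rewrite mxE gt_max ax bx.
Qed.

Lemma measurable_rV_orthants : @measurable _ 'rV[R]_n = <<s range orthant >>.
Proof.
apply/seteqP; split; apply: smallest_sub.
- exact: smallest_sigma_algebra.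
- move=> A; rewrite -bigcup_seq/= => -[i _ [B mB <-]] /=; rewrite setTI.
  pose S := [set B : set R | <<s range orthant >> (rV_coord i @^-1` B)].
  have mE : @measurable _ (measurableTypeR R) = _ := RGenOInfty.measurableE R.
  suff : <<s @RGenOInfty.G R >> `<=` S by apply; rewrite mE in mB.
   apply: smallest_sub.
    split; rewrite /S /=.
    + by rewrite preimage_set0; exact: sigma_algebra0.
    + move=> C SC; rewrite setTD preimage_setC -setTD.
      exact: sigma_algebraCD.
    + by move=> F SF; rewrite preimage_bigcup; exact: sigma_algebra_bigcup.
  move=> _ [b ->]; rewrite /S/=.
  rewrite (_ : _ @^-1` _ = \bigcup_k orthant
      (\row_j if j == i then b else - k%:R)).
    apply: (@sigma_algebra_bigcup _ _ (range orthant)) => k.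
    by apply: sub_sigma_algebra; eexists.
  apply/seteqP; split => x /=; rewrite /rV_coord in_itv/= andbT.
    move=> bx; exists (Num.truncn `|x|).+1 => // j; rewrite mxE.
    case: eqP => [->//|_]; rewrite ltrNl; apply: le_lt_trans (truncnS_gt _).
    by apply: le_trans (rV_coord_le_norm x j); rewrite -normrN ler_norm.
  by move=> [k _ /(_ i)]; rewrite mxE eqxx.
- exact: sigma_algebra_measurable.
- by move=> _ [a _ <-]; exact: measurable_orthant.
Qed.

(** The orthants form a generating pi-system, so that a function is determined
    by its integrals over them. *)
Lemma integral_orthant_eq0 (K : 'rV[R]_n -> \bar R) :
  mu.-integrable setT K -> (\int[mu]_x K x = 0)%E ->
  (forall a, \int[mu]_(x in orthant a) K x = 0)%E ->
  {ae mu, forall x, K x = 0%E}.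
Proof.
move=> iK K0 oK.
have iKS A : measurable A -> mu.-integrable A K.
  by move=> mA; exact: integrableS iK.
suff KA A : measurable A -> (\int[mu]_(x in A) K x = 0)%E.
  have := @integral_ae_eq _ _ _ mu setT measurableT (cst 0%E) K iK.
  have KE E : E `<=` setT -> measurable E ->
      (\int[mu]_(x in E) K x = \int[mu]_(x in E) cst 0 x)%E.
    by move=> _ mE; rewrite KA// integral0.
  by move=> /(_ (measurable_cst _) KE); apply: filterS => x; exact.
rewrite measurable_rV_orthants => mA.
apply: (dynkin_induction (G := range orthant)
  (P := fun A => (\int[mu]_(x in A) K x = 0)%E)) mA => //.
- exact: measurable_rV_orthants.
- exact: setI_closed_orthant.
- by move=> _ [a _ <-]; exact: oK.
- move=> B mB KB; have := K0; rewrite -(setUv B) integral_setU ?KB ?add0e//.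
  + exact: measurableC.
  + by rewrite setUv; exact: measurable_int iK.
  + by rewrite disj_set2E setICr.
- move=> B mB tB KB; rewrite integral_bigcup//.
    by rewrite eseries0// => i _ _; exact: KB.
  by apply: iKS; exact: bigcup_measurable.
Qed.

End orthants.

(** * Null hyperplanes and balls of finite measure *)

Section null_and_finite_sets.
Context (R : realType) (n : nat).
Local Notation mu := (lebesgue_rV R n).

Lemma negligible_hyperplane (i : 'I_n) (c : R) :
  mu.-negligible [set x : 'rV[R]_n | x 0 i = c].
Proof.
pose A (j : 'I_n) : set (measurableTypeR R) := if j == i then [set c] else setT.
have mA j : measurable (A j) by rewrite /A; case: ifP.
exists [set x : 'rV[R]_n | forall j, A j (x 0 j)]; split.
- exact: measurable_rV_box.
- rewrite (lebesgue_rV_box mA) (bigD1 i)//= {1}/A eqxx.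
  by rewrite lebesgue_measure_set1 mul0e.
- by move=> x /= xc j; rewrite /A; case: eqP => // ->.
Qed.

Lemma lebesgue_rV_ball_lty (x : 'rV[R]_n) (r : R) : (mu (ball x r) < +oo)%E.
Proof.
pose A (i : 'I_n) : set (measurableTypeR R) := ball (x 0 i) r.
have mA i : measurable (A i) by exact: measurable_ball.
have : mu [set y : 'rV[R]_n | forall i, A i (y 0 i)] \is a fin_num.
  rewrite (lebesgue_rV_box mA).
  elim/big_ind : _ => // [a b|i _]; first exact: fin_numM.
  by rewrite /A ball_itv lebesgue_measure_itv/=; case: ifPn.
move=> /fin_numPlt/andP[_]; apply: le_lt_trans; apply: le_measure; rewrite ?inE.
- exact: measurable_rV_ball.
- exact: measurable_rV_box.
- by move=> y [_ xy] i; exact: xy.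
Qed.

Lemma bounded_subset_ball (D : set 'rV[R]_n) : bounded_set D ->
  exists2 r, 0 < r & D `<=` ball (0 : 'rV[R]_n) r.
Proof.
move=> [M [_ MD]]; exists (`|M| + 2); first by rewrite ltr_wpDl.
move=> x Dx; rewrite -ball_normE /ball_/= sub0r normrN.
have : `|x| <= `|M| + 1.
  by apply: (MD (`|M| + 1)) => //; rewrite (le_lt_trans (ler_norm M))// ltrDl.
by move=> /le_lt_trans; apply; rewrite ltrD2l ltr1n.
Qed.

End null_and_finite_sets.

(** * Smooth functions of one variable *)

Section smooth_functions.
Context (R : realType).
Implicit Types (q : R -> R) (P : {poly R}).

(** [q] can be differentiated [k] times on the whole line. *)
Fixpoint times_derivable (k : nat) q : Prop :=
  if k is k'.+1 then
    exists2 q', (forall t : R, is_derive t 1 q (q' t)) & times_derivable k' q'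
  else True.

(** Smooth functions of one real variable. *)
Definition smooth1 q := forall k, times_derivable k q.

Lemma times_derivableS k q : times_derivable k.+1 q -> times_derivable k q.
Proof.
elim: k q => // k IH q [q' qq' kq']; exists q' => //; exact: IH.
Qed.

Lemma times_derivableD k q r : times_derivable k q -> times_derivable k r ->
  times_derivable k (q \+ r).
Proof.
elim: k q r => // k IH q r [q' qq' kq'] [r' rr' kr'].
exists (q' \+ r'); last exact: IH.
by move=> t; exact: is_deriveD.
Qed.

Lemma times_derivableM k q r : times_derivable k q -> times_derivable k r ->
  times_derivable k (q \* r).
Proof.
elim: k q r => // k IH q r qk rk.
have [q' qq' kq'] := qk; have [r' rr' kr'] := rk.
exists ((q \* r') \+ (r \* q')).
  by move=> t; exact: is_deriveM.
by apply: times_derivableD; apply: IH => //; exact: times_derivableS.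
Qed.

Lemma times_derivable_cst k c : times_derivable k (cst c).
Proof.
elim: k c => // k IH c; exists (cst 0) => // t; exact: is_derive_cst.
Qed.

Lemma times_derivable_affine k q (a b : R) : times_derivable k q ->
  times_derivable k (fun t => q (a * t + b)).
Proof.
elim: k q => // k IH q [q' qq' kq'].
exists (cst a \* (fun t => q' (a * t + b))).
  move=> t; have da : is_derive t 1 (fun t => a * t + b) a.
    have : is_derive t 1 (a *: id + cst b : R -> R) (a *: 1 + 0).
      exact: is_deriveD.
    by rewrite addr0 /GRing.scale/= mulr1.
  by rewrite /= mulrC; exact: (@is_derive1_comp R q _ t).
by apply: times_derivableM; [exact: times_derivable_cst|exact: IH].
Qed.

Lemma smooth1D q r : smooth1 q -> smooth1 r -> smooth1 (q \+ r).
Proof. by move=> sq sr k; exact: times_derivableD. Qed.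

Lemma smooth1M q r : smooth1 q -> smooth1 r -> smooth1 (q \* r).
Proof. by move=> sq sr k; exact: times_derivableM. Qed.

Lemma smooth1_cst c : smooth1 (cst c).
Proof. by move=> k; exact: times_derivable_cst. Qed.

Lemma smooth1_affine q (a b : R) : smooth1 q -> smooth1 (fun t => q (a * t + b)).
Proof. by move=> sq k; exact: times_derivable_affine. Qed.

Lemma smooth1_antiderivative q q' : (forall t : R, is_derive t 1 q (q' t)) ->
  smooth1 q' -> smooth1 q.
Proof. by move=> qq' sq' [//|k]; exists q'. Qed.

Lemma smooth1_derivative q : smooth1 q ->
  (forall t : R, is_derive t 1 q (q^`()%classic t)) /\ smooth1 q^`()%classic.
Proof.
move=> sq.
have dq (t : R) : is_derive t 1 q (q^`()%classic t).
  have [q' qq' _] := sq 1%N.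
  by rewrite derive1E; apply: derivableP; have [] := qq' t.
split => // k; have [q' qq' kq'] := sq k.+1.
suff -> : q^`()%classic = q' by [].
apply/funext => t; rewrite derive1E; exact: derive_val.
Qed.

Lemma smooth1_continuous q : smooth1 q -> continuous q.
Proof.
move=> /smooth1_derivative[dq _] t.
by apply/differentiable_continuous/derivable1_diffP; have [] := dq t.
Qed.

Lemma exprn_le_expR (k : nat) : exists2 C : R, 0 <= C &
  forall y, 0 <= y -> y ^+ k <= C * expR y.
Proof.
case: k => [|k]; first by exists 1 => // y y0; rewrite mul1r expr0 -expR0 ler_expR.
exists (k.+1%:R ^+ k.+1); first exact: exprn_ge0.
move=> y y0; have k0 : k.+1%:R != 0 :> R by rewrite pnatr_eq0.
(* [y ^ k = k ^ k (y / k) ^ k], and [y / k <= exp (y / k)]. *)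
have -> : y = k.+1%:R * (y / k.+1%:R) by rewrite mulrCA divff// mulr1.
set z := y / _; have z0 : 0 <= z by exact: divr_ge0.
rewrite exprMn expRM_natl ler_wpM2l// ?exprn_ge0//.
apply: lerXn2r; rewrite ?nnegrE ?expR_ge0//.
by apply: le_trans (expR_ge1Dx z); rewrite lerDr.
Qed.

Lemma horner_le_expR P : exists2 C : R, 0 <= C &
  forall y, 0 <= y -> `|P.[y]| <= C * expR y.
Proof.
have /choice[C CP] (i : nat) : exists C : R, 0 <= C /\
    forall y, 0 <= y -> y ^+ i <= C * expR y.
  by have [C ? ?] := exprn_le_expR i; exists C.
exists (\sum_(i < size P) `|P`_i| * C i).
  by apply: sumr_ge0 => i _; apply: mulr_ge0 => //; have [] := CP i.
move=> y y0; rewrite horner_coef; apply: le_trans (ler_norm_sum _ _ _) _.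
rewrite mulr_suml; apply: ler_sum => i _.
rewrite normrM -mulrA ler_wpM2l// ger0_norm ?exprn_ge0//.
by have [_] := CP i; exact.
Qed.

(** The functions [P(1/t) exp(-1/t)], extended by [0] to [t <= 0], form a
    class which is closed under derivation. *)
Definition flat P (t : R) : R := if 0 < t then P.[t^-1] * expR (- t^-1) else 0.

Lemma flat_ge0 t : 0 <= flat 1 t.
Proof. by rewrite /flat; case: ifP => // _; rewrite hornerC mul1r expR_ge0. Qed.

Lemma flat_le1 t : flat 1 t <= 1.
Proof.
rewrite /flat; case: ifPn => // t0; rewrite hornerC mul1r -expR0 ler_expR.
by rewrite oppr_le0 invr_ge0 ltW.
Qed.

(** The difference quotients of [flat P] at the origin tend to zero, because
    the exponential dominates every polynomial. *)
Lemma flat_quotient P : exists2 C : R, 0 <= C &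
  forall t, `|t^-1 * flat P t| <= C * `|t|.
Proof.
have [C C0 CP] := horner_le_expR (P * 'X^2); exists C => // t.
rewrite /flat; case: ifPn => t0; last by rewrite mulr0 normr0 mulr_ge0.
have y0 : 0 < t^-1 by rewrite invr_gt0.
rewrite (gtr0_norm t0) -[X in _ <= _ * X]invrK; move: (t^-1) y0 => y y0.
have := CP y (ltW y0); rewrite hornerM hornerXn !normrM.
rewrite (gtr0_norm y0) (gtr0_norm (expR_gt0 _)) => Py.
rewrite ler_pdivlMr// -(ler_pM2r (expR_gt0 y)); apply: le_trans Py.
rewrite expRN; have := gt_eqF (expR_gt0 y); set E := expR y => /negbT E0.
by rewrite le_eqVlt; apply/orP; left; apply/eqP; field.
Qed.

Lemma is_derive_flat P (t : R) :
  is_derive t 1 (flat P) (flat ('X^2 * (P - P^`())%R) t).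
Proof.
have [t0|t0|->] := ltgtP t 0.
- rewrite {2}/flat ltNge (ltW t0)/=.
  apply: (@near_eq_is_derive _ _ _ (cst 0)) => //.
  by near=> s; rewrite /flat ltNge ltW//=; near: s; exact: lt_nbhsl.
- rewrite {2}/flat t0.
  have Pflat : \forall s \near t, P.[s^-1] * expR (- s^-1) = flat P s.
    by near=> s; rewrite /flat ifT//; near: s; exact: lt_nbhsr.
  apply: (near_eq_is_derive Pflat).
  have dV : is_derive t 1 (fun s : R => s^-1) (- t ^- 2).
    have := @is_deriveV R id t 1 1; rewrite gt_eqF// => /(_ isT (is_derive_id _ _)).
    by rewrite /GRing.scale/= mulr1.
  have dP : is_derive t 1 (fun s => P.[s^-1]) (P^`().[t^-1] * - t ^- 2).
    exact: (@is_derive1_comp R (horner P) (fun s : R => s^-1) t).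
  have dN : is_derive t 1 (fun s : R => - s^-1) (t ^- 2).
    by rewrite -[t ^- 2]opprK; exact: is_deriveN.
  have dE : is_derive t 1 (fun s : R => expR (- s^-1)) (expR (- t^-1) * t ^- 2).
    exact: (@is_derive1_comp R expR (fun s : R => - s^-1) t).
  have dPE : is_derive t 1 (fun s => P.[s^-1] * expR (- s^-1)) _ :=
    is_deriveM dP dE.
  apply: (is_derive_eq dPE).
  rewrite /GRing.scale/= !hornerE/= exprVn; ring.
- have -> : flat ('X^2 * (P - P^`())%R) 0 = 0 by rewrite /flat ltxx.
  have [C C0 CP] := flat_quotient P.
  have cv : h^-1 *: (flat P (h *: 1 + 0) - flat P 0) @[h --> (0 : R)^'] --> (0 : R).
    apply: cvg_within_filter => //.
    apply/cvgr0Pnorm_lt => e e0.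
    have e1 : 0 < e / (C + 1) by rewrite divr_gt0// ltr_wpDl.
    have he := @pseudometric_normed_Zmodule.nbhs0_lt R R _ e1.
    near=> h.
    rewrite /GRing.scale/= mulr1 addr0 {2}/flat ltxx subr0.
    apply: le_lt_trans (CP h) _.
    have : `|h| < e / (C + 1) by near: h; exact: he.
    rewrite ltr_pdivlMr ?ltr_wpDl// => /(le_lt_trans _); apply.
    by rewrite mulrC ler_wpM2l// lerDl.
  by apply: DeriveDef; [apply/cvg_ex; exists 0|exact/cvg_lim].
Unshelve. all: by end_near. Qed.

Lemma smooth1_flat P : smooth1 (flat P).
Proof.
move=> k; elim: k P => // k IH P.
exists (flat ('X^2 * (P - P^`())%R)) => // t; exact: is_derive_flat.
Qed.

End smooth_functions.

(** * Test functions of product form *)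

Section product_functions.
Context (R : realType) (n : nat).
Implicit Types (q : 'I_n.+1 -> R -> R) (x : 'rV[R]_n.+1).

Lemma norm_le_rV_coord x (r : R) : 0 <= r -> (forall i, `|x 0 i| <= r) ->
  `|x| <= r.
Proof.
move=> r0 xr; rewrite [leLHS]/Num.norm /= mx_normrE; apply/bigmax_leP.
by split => // -[i j] _ /=; rewrite (ord1 i).
Qed.

(** The function [x |-> q_0(x_0) ... q_n(x_n)]. *)
Definition prod_fun q x : R := \prod_i q i (x 0 i).

(** The family [q] with its [i]-th member replaced by [r]. *)
Definition replace q (i : 'I_n.+1) (r : R -> R) : 'I_n.+1 -> R -> R :=
  fun j => if j == i then r else q j.

Lemma prod_funE q i r x :
  prod_fun (replace q i r) x = r (x 0 i) * \prod_(j | j != i) q j (x 0 j).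
Proof.
rewrite /prod_fun (bigD1 i)//= {1}/replace eqxx; congr (_ * _).
by apply: eq_bigr => j /negbTE ji; rewrite /replace ji.
Qed.

Lemma prod_funD1 q i x :
  prod_fun q x = q i (x 0 i) * \prod_(j | j != i) q j (x 0 j).
Proof. by rewrite /prod_fun (bigD1 i). Qed.

Lemma is_derive_prod_fun q (i : 'I_n.+1) x (d : R) :
  is_derive (x 0 i) 1 (q i) d ->
  is_derive x (delta_mx ord0 i) (prod_fun q)
    (d * \prod_(j | j != i) q j (x 0 j)).
Proof.
move=> qd; set c := \prod_(j | _) _.
have gd : is_derive (x 0 i) 1 (c *: q i : R -> R) (c *: d) by exact: is_deriveZ.
(* On the line through [x] in the [i]-th direction the product is the constant
   [c] times [q i]. *)
have lineE : (fun h : R => h^-1 *: (prod_fun q (h *: delta_mx ord0 i + x)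
      - prod_fun q x)) =
    (fun h : R => h^-1 *: ((c *: q i : R -> R) (h *: 1 + x 0 i)
      - (c *: q i : R -> R) (x 0 i))).
  apply/funext => h; congr (_ *: _); rewrite !(prod_funD1 q i).
  rewrite !mxE !eqxx mulr1 /= [_ * c]mulrC; congr (_ - _).
  rewrite mulrC; congr (_ * q i _); last by rewrite /GRing.scale/= mulr1.
  by apply: eq_bigr => j /negbTE ji; rewrite !mxE eqxx ji mulr0 add0r.
rewrite (_ : d * c = c *: d); last by rewrite mulrC.
have [dg <-] := gd; apply: DeriveDef.
  by move: dg; rewrite /derivable lineE.
by rewrite /derive lineE.
Qed.

Lemma continuous_prod_fun q : (forall i, continuous (q i)) ->
  continuous (prod_fun q).
Proof.
move=> cq; rewrite /prod_fun; elim: (index_enum _) => [|i s IH].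
  rewrite (_ : (fun _ => _) = cst 1); first exact: cst_continuous.
  by apply/funext => x; rewrite big_nil.
rewrite (_ : (fun _ => _) =
    (fun x => q i (x 0 i) * \prod_(j <- s) q j (x 0 j))); last first.
  by apply/funext => x; rewrite big_cons.
move=> x; have ci : {for x, continuous (fun y : 'rV[R]_n.+1 => y 0 i)}.
  exact: coord_continuous.
exact: (continuousM (continuous_comp ci (cq i _)) (IH x)).
Qed.

Lemma partial_prod_fun q i : (forall j, smooth1 (q j)) ->
  partial i (prod_fun q) = prod_fun (replace q i (q i)^`()%classic).
Proof.
move=> sq; apply/funext => x; rewrite prod_funE.
have [dq _] := smooth1_derivative (sq i).
by have := is_derive_prod_fun (dq (x 0 i)) => dp; exact: derive_val.
Qed.

Lemma smooth_prod_fun q : (forall j, smooth1 (q j)) -> smooth (prod_fun q).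
Proof.
move=> sq s.
have [q' -> sq'] : exists2 q', foldr (@partial R n) (prod_fun q) s = prod_fun q' &
    forall j, smooth1 (q' j).
  elim: s => [|i s [q' /= -> sq']]; first by exists q.
  exists (replace q' i (q' i)^`()%classic); first exact: partial_prod_fun.
  move=> j; rewrite /replace; case: ifP => // _.
  by have [] := smooth1_derivative (sq' i).
split.
  by apply: continuous_prod_fun => i; exact: smooth1_continuous.
move=> i x; have [dq _] := smooth1_derivative (sq' i).
by have [] := is_derive_prod_fun (dq (x 0 i)).
Qed.

Lemma test_function_prod_fun (Omega : set 'rV[R]_n.+1) q
    (c : 'rV[R]_n.+1) (r : R) :
  0 <= r -> (forall j, smooth1 (q j)) ->
  (forall j t, q j t != 0 -> `|c 0 j - t| <= r) ->
  [set x : 'rV[R]_n.+1 | `|c - x| <= r] `<=` Omega -> test_function Omega (prod_fun q).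
Proof.
move=> r0 sq qr rO; split; first exact: smooth_prod_fun.
have sub : closure [set x | prod_fun q x != 0] `<=` [set x : 'rV[R]_n.+1 | `|c - x| <= r].
  rewrite [X in _ `<=` X](closure_id _).1; last exact: closed_closed_ball_.
  apply: closureS => x /= qx; apply: norm_le_rV_coord => // i.
  rewrite !mxE; apply: qr; apply: contraNneq qx => qi0.
  by rewrite (prod_funD1 q i) qi0 mul0r.
split; last exact: subset_trans rO.
apply: bounded_closed_compact; last exact: closed_closure.
exists (`|c| + r); split; first exact: num_real.
move=> M cM x /sub /= cx; apply: le_trans (ltW cM).
rewrite -[leLHS](_ : `|c - (c - x)| = _); last by rewrite opprB addrC subrK.
by rewrite (le_trans (ler_normB _ _))// lerD2l.
Qed.

End product_functions.

(** * Shears of the product with the real line *)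

Section shear.
Context (R : realType) (n : nat).
Local Notation mu := (lebesgue_rV R n).
Local Notation lambda := (@lebesgue_measure R).
Implicit Types (d : 'rV[R]_n).

(** The map [(x, t) |-> (x + t d, t)], which preserves the product measure. *)
Definition shear d (p : 'rV[R]_n * measurableTypeR R) :
  'rV[R]_n * measurableTypeR R := (p.1 + (p.2 : R) *: d, p.2).

Lemma measurable_shear d : measurable_fun setT (shear d).
Proof.
apply/measurable_fun_pairP; split; last exact: measurable_snd.
apply: measurable_fun_rVP => i; rewrite /rV_coord /comp/=.
under eq_fun do rewrite !mxE.
apply: measurable_funD.
  exact: (measurableT_comp (measurable_rV_coord i) measurable_fst).
apply: (measurable_funM (f := fun p : 'rV[R]_n * measurableTypeR R => (p.2 : R))) => //.
exact: measurable_snd.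
Qed.

Lemma integrable_shear d (f : 'rV[R]_n * measurableTypeR R -> \bar R) :
  (mu \x lambda)%E.-integrable setT f ->
  (mu \x lambda)%E.-integrable setT (f \o shear d).
Proof.
move=> intf; have mf := measurable_int _ intf.
have mfs : measurable_fun setT (f \o shear d).
  by apply: measurableT_comp => //; exact: measurable_shear.
apply/(integrable21ltyP _ _ mfs); have /(integrable21ltyP _ _ mf) := intf.
apply: le_lt_trans; rewrite le_eqVlt; apply/orP; left; apply/eqP.
apply: eq_integral => t _.
rewrite (ge0_integral_translation ((t : R) *: d) (g := fun x => `|f (x, t)|%E))//.
apply: measurableT_comp => //; exact: measurableT_comp.
Qed.

Lemma integral_shear d (f : 'rV[R]_n * measurableTypeR R -> \bar R) :
  (mu \x lambda)%E.-integrable setT f ->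
  (\int[mu]_x \int[lambda]_t (f \o shear d) (x, t) =
   \int[mu]_x \int[lambda]_t f (x, t))%E.
Proof.
move=> intf; have intfs := integrable_shear d intf.
rewrite (Fubini intfs) (Fubini intf).
apply: ae_eq_integral => //.
- exact: (measurable_fubini_G intfs).
- exact: (measurable_fubini_G intf).
- apply: filterS (ae_integrable2 intf) => t intft _ /=.
  by rewrite /shear/= (integral_translation ((t : R) *: d)
    (g := fun x => f (x, t))).
Qed.

Lemma integrable_tensor_itv (a b C : R) (g : 'rV[R]_n -> R)
    (k : 'rV[R]_n * measurableTypeR R -> R) :
  mu.-integrable setT (EFin \o g) -> measurable_fun setT k ->
  (forall p, `|k p| <= C) ->
  (mu \x lambda)%E.-integrable setT
    (fun p => (g p.1 * k p * \1_`[a, b] (p.2 : R))%:E).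
Proof.
move=> intg mk kC; have /measurable_EFinP mg := measurable_int _ intg.
have C0 : 0 <= C by apply: le_trans (kC (0, 0)).
have lab : lambda `[a, b]%classic \is a fin_num.
  by rewrite lebesgue_measure_itv/=; case: ifPn.
have m1 : measurable_fun setT
    (fun p : 'rV[R]_n * measurableTypeR R => \1_(`[a, b]%classic) (p.2 : R) : R).
  apply: (measurableT_comp (f := \1_(`[a, b]%classic) : measurableTypeR R -> R)).
    exact: measurable_indic.
  exact: measurable_snd.
have mg1 : measurable_fun setT
    (fun p : 'rV[R]_n * measurableTypeR R => g p.1).
  exact: measurableT_comp.
have mgk : measurable_fun setT
    (fun p : 'rV[R]_n * measurableTypeR R =>
      (g p.1 * k p * \1_(`[a, b]%classic) (p.2 : R))%:E).
  apply/measurable_EFinP; apply: measurable_funM => //; exact: measurable_funM.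
have mabs : measurable_fun setT
    (fun p : 'rV[R]_n * measurableTypeR R =>
      `|(g p.1 * k p * \1_(`[a, b]%classic) (p.2 : R))%:E|%E).
  exact: measurableT_comp.
apply/(integrable12ltyP _ _ mgk).
apply: (@le_lt_trans _ _
  (\int[mu]_x ((C * fine (lambda `[a, b]%classic))%:E * `|(g x)%:E|))%E).
  apply: ge0_le_integral => //.
  - by move=> x _; exact: integral_ge0.
  - exact: (measurable_fun_fubini_tonelli_F _ mabs (fun _ => abse_ge0 _)).
  - apply: emeasurable_funM => //; apply: measurableT_comp => //;
      exact/measurable_EFinP.
  - move=> x _.
    apply: (@le_trans _ _ (\int[lambda]_t ((`|g x| * C)%:E * (\1_`[a, b] (t : R))%:E))%E).
      apply: ge0_le_integral => //.
      + apply: measurableT_comp => //.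
        have := measurableT_comp mgk (@pair1_measurable _ _ _ _ x); exact.
      + apply: emeasurable_funM => //; apply/measurable_EFinP; exact: measurable_indic.
      + move=> t _; rewrite -EFinM lee_fin !normrM.
        rewrite [X in _ * X]ger0_norm// ler_wpM2r//.
        by rewrite ler_wpM2l.
    rewrite ge0_integralZl//; last 2 first.
    - by apply/measurable_EFinP; exact: measurable_indic.
    - by rewrite lee_fin mulr_ge0.
    rewrite integral_indic// setIT -[X in (_ * X <= _)%E](fineK lab).
    rewrite abse_EFin -!EFinM lee_fin le_eqVlt; apply/orP; left; apply/eqP; ring.
rewrite ge0_integralZl//.
- by apply: lte_mul_pinfty => //; [rewrite lee_fin mulr_ge0// fine_ge0|case/integrableP: intg].
- by apply: measurableT_comp => //; exact/measurable_EFinP.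
- by rewrite lee_fin mulr_ge0// fine_ge0.
Qed.

End shear.

(** * Integrals over segments *)

Section segment_integral.
Context (R : realType) (n : nat).
Local Notation mu := (lebesgue_rV R n).
Local Notation lambda := (@lebesgue_measure R).
Implicit Types (x d : 'rV[R]_n) (g b : 'rV[R]_n -> R).

(** The integral of [g] over the segment from [x] to [x + h d], with respect to
    the parameter. *)
Definition segint g d (h : R) x : R :=
  \int[lambda]_(t in `[0, h]) g (x + t *: d).

Let segint_fun g d h (p : 'rV[R]_n * measurableTypeR R) :=
  (g (p.1 + (p.2 : R) *: d) * \1_`[0, h] (p.2 : R))%:E.

Lemma segintE g d h x :
  segint g d h x = fine (\int[lambda]_t segint_fun g d h (x, t))%E.
Proof.
rewrite /segint /Rintegral integral_mkcond; congr fine; apply: eq_integral => t _.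
rewrite /segint_fun/= indicE /= patchE.
by case: ifPn; rewrite /= ?mulr1 ?mulr0.
Qed.

Lemma integrable_segint_fun g d h : mu.-integrable setT (EFin \o g) ->
  (mu \x lambda)%E.-integrable setT (segint_fun g d h).
Proof.
move=> ig.
have := @integrable_tensor_itv R n 0 h 1 g (cst 1) ig (measurable_cst _).
rewrite /= normr1 => /(_ (fun=> lexx _)) it.
have := integrable_shear d it; apply: eq_integrable => // p _.
by rewrite /segint_fun/= mulr1.
Qed.

Lemma integrable_segint g d h : mu.-integrable setT (EFin \o g) ->
  mu.-integrable setT (EFin \o segint g d h).
Proof.
move=> /(integrable_segint_fun d h) /integrable_fubini_F.
set F := fubini_F _ _ => iF; apply: (le_integrable _ _ _ iF) => //.
- apply/measurable_EFinP; rewrite (_ : segint g d h = fine \o F); last first.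
    by apply/funext => x; exact: segintE.
  by apply: measurableT_comp => //; exact: measurable_int iF.
- move=> x _ /=; rewrite (_ : segint g d h x = fine (F x)); last exact: segintE.
  by case: (F x) => [r| |] /=; rewrite ?lexx ?leey.
Qed.

Lemma measurable_minus_segment b d : measurable_fun setT b ->
  measurable_fun setT (fun p : 'rV[R]_n * measurableTypeR R =>
    b (p.1 - (p.2 : R) *: d)).
Proof.
move=> mb; have := measurableT_comp mb (measurableT_comp measurable_fst
  (measurable_shear (- d))); rewrite /comp/= /shear/=.
by under eq_fun do rewrite scalerN.
Qed.

(** Fubini's theorem and the invariance under translations exchange the
    segment integral with the multiplication by a bounded weight. *)
Lemma integral_segint_adjoint g b (C : R) d h :
  mu.-integrable setT (EFin \o g) -> measurable_fun setT b ->
  (forall x, `|b x| <= C) ->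
  \int[mu]_x (g x * segint b (- d) h x) = \int[mu]_x (b x * segint g d h x).
Proof.
move=> ig mb bC; rewrite /Rintegral; congr fine.
have ik := integrable_tensor_itv 0 h ig (measurable_minus_segment d mb)
  (fun p => bC _).
transitivity (\int[mu]_x \int[lambda]_t
    (g x * b (x - (t : R) *: d) * \1_`[0, h] (t : R))%R%:E)%E.
  apply: eq_integral => x _; rewrite EFinM segintE.
  under [in RHS]eq_integral do rewrite -mulrA EFinM.
  have ib : lambda.-integrable setT
      (fun t => (b (x - (t : R) *: d) * \1_`[0, h] (t : R))%:E).
    have := measurableT_comp (measurable_minus_segment d mb)
      (@pair1_measurable _ _ _ (measurableTypeR R) x).
    rewrite /comp/= => mbx.
    have i1 : lambda.-integrable setT (fun t => (C * \1_`[0, h] (t : R))%:E).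
      under eq_fun do rewrite EFinM.
      by apply: integrableZl => //; exact: (@integrable_indic_itv R 0 h true false).
    apply: (le_integrable _ _ _ i1) => //.
      by apply/measurable_EFinP; apply: measurable_funM => //; exact: measurable_indic.
    move=> t _; rewrite lee_fin !normrM ler_wpM2r//.
    by rewrite (le_trans (bC _))// ler_norm.
  rewrite integralZl// fineK//.
    congr (_ * _)%E; apply: eq_integral => t _.
    by rewrite /segint_fun/= scalerN.
  apply: integrable_fin_num => //; apply: eq_integrable ib => // t _.
  by rewrite /segint_fun/= scalerN.
rewrite -(integral_shear d ik).
have ig1 := integrable_segint_fun d h ig.
apply: eq_integral_ae; apply: filterS (ae_integrable1 ig1) => x igx _ /=.
under eq_integral => t _ do
  rewrite /shear/= addrK [_ * b x]mulrC -mulrA EFinM.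
rewrite integralZl// segintE EFinM fineK//.
exact: integrable_fin_num.
Qed.

End segment_integral.

(** * The difference identity against smooth bumps *)

Section difference_identity.
Context (R : realType).
Local Notation lambda := (@lebesgue_measure R).

Lemma antiderivative_exists (q : R -> R) (a b : R) : continuous q ->
  (forall t, q t != 0 -> a <= t <= b) ->
  exists B : R -> R, forall t : R, is_derive t 1 B (q t).
Proof.
move=> cq qab.
have mq : measurable_fun setT q by exact: continuous_measurable_fun.
have iq : lambda.-integrable setT (EFin \o q).
  have : lambda.-integrable `[a, b] (EFin \o q).
    apply: continuous_compact_integrable; first exact: segment_compact.
    exact: continuous_subspaceT.
  move=> /((integrable_mkcond (mu := lambda) (EFin \o q) (measurable_itv _)).1).
  apply: eq_integrable => // t _.
  rewrite patchE; case: ifPn => //=; rewrite notin_setE/= in_itv/= => tab.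
  by have [->//|/qab] := eqVneq (q t) 0.
exists (fun y => \int[lambda]_(t in [set` Interval -oo%O (BRight y)]) (q t)) => t.
have [] := @continuous_FTC1 R q -oo%O t (t + 1) _ _ _ (cq t) => //.
- by rewrite ltrDl.
- exact: integrableS iq.
- by rewrite ltNyr.
by move=> dB <-; rewrite derive1E; exact: derivableP.
Qed.

Lemma integral_derivative (q B : R -> R) (s c h : R) : 0 < h -> s * s = 1 ->
  continuous q -> (forall t : R, is_derive t 1 B (q t)) ->
  \int[lambda]_(t in `[0, h]) q (c - s * t) = s * (B c - B (c - s * h)).
Proof.
move=> h0 ss cq dB.
pose A t := - s * B (c - s * t).
have dlin (t : R) : is_derive t 1 (fun t => c - s * t) (- s).
  have : is_derive t 1 (cst c - s *: id : R -> R) (0 - s *: 1).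
    exact: is_deriveB.
  by rewrite sub0r /GRing.scale/= mulr1.
have dA (t : R) : is_derive t 1 A (q (c - s * t)).
  have dBt : is_derive t 1 (fun t => B (c - s * t)) (q (c - s * t) * - s).
    exact: (@is_derive1_comp R B (fun t => c - s * t)).
  have := is_deriveZ (- s) dBt.
  by rewrite /GRing.scale/= mulrCA mulrNN ss mulr1.
have cA : continuous A.
  move=> t; apply/differentiable_continuous/derivable1_diffP.
  by have [] := dA t.
have clin : continuous (fun t : R => q (c - s * t)).
  move=> t; apply: (@continuous_comp _ _ _ (fun t : R => c - s * t) q); last exact: cq.
  by apply/differentiable_continuous/derivable1_diffP; have [] := dlin t.
rewrite /Rintegral (@continuous_FTC2 R _ A)//=.
- by rewrite /A mulr0 subr0; ring.
- exact: continuous_subspaceT.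
- split.
  + by move=> t _; have [] := dA t.
  + by apply: cvg_at_right_filter; exact: cA.
  + by apply: cvg_at_left_filter; exact: cA.
- by move=> t _; rewrite derive1E; exact: derive_val.
Qed.

Context (n : nat).
Local Notation mu := (lebesgue_rV R n.+1).
Variables (Omega : set 'rV[R]_n.+1) (W G : 'rV[R]_n.+1 -> R).
Hypothesis iW : mu.-integrable setT (EFin \o W).
Hypothesis iG : mu.-integrable setT (EFin \o G).
Variable i : 'I_n.+1.
Hypothesis weak : forall phi, test_function Omega phi ->
  \int[mu]_x (W x * partial i phi x) = - \int[mu]_x (G x * phi x).

Section signed_direction.
Variable s : R.
Hypothesis ss : s * s = 1.
Let d : 'rV[R]_n.+1 := s *: delta_mx ord0 i.

(** The failure of the fundamental theorem of calculus between [x] and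
    [x + h d], where [W] stands for a primitive of [G] in the [i]-th direction.
    The sign [s] gives access to both orientations. *)
Definition difference_defect (h : R) x : R :=
  W (x + h *: d) - W x - s * segint G d h x.

Lemma integrable_difference_defect h :
  mu.-integrable setT (EFin \o difference_defect h).
Proof.
have iWh : mu.-integrable setT (EFin \o (fun x : 'rV[R]_n.+1 => W (x + h *: d))).
  exact: (integrable_translation (h *: d) iW).
have isG : mu.-integrable setT (EFin \o (fun x => s * segint G d h x)).
  exact: (integrableZl measurableT s (integrable_segint d h iG)).
have := integrableB measurableT (integrableB measurableT iWh iW) isG.
exact: eq_integrable.
Qed.

Let integrable_bounded (g b : 'rV[R]_n.+1 -> R) (C : R) :
  mu.-integrable setT (EFin \o g) -> measurable_fun setT b ->
  (forall x, `|b x| <= C) -> mu.-integrable setT (EFin \o (fun x => g x * b x)).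
Proof.
move=> ig mb bC; have iC := integrableZl measurableT C ig.
apply: (le_integrable _ _ _ iC) => //.
  apply/measurable_EFinP; apply: measurable_funM => //.
  by apply/measurable_EFinP; exact: measurable_int ig.
move=> x _; rewrite /= lee_fin !normrM [leLHS]mulrC ler_wpM2r//.
by rewrite (le_trans (bC x))// ler_norm.
Qed.

(** The test function is the integral of the bump [prod_fun q] over the
    segments of direction [- d]: its [i]-th derivative is a difference of two
    translates of the bump, which translation invariance moves onto [W]. *)
Lemma difference_defect_bump (c : 'rV[R]_n.+1) (r h : R)
    (q : 'I_n.+1 -> R -> R) :
  0 < h <= r -> [set x : 'rV[R]_n.+1 | `|c - x| <= 2 * r] `<=` Omega ->
  (forall j, smooth1 (q j)) ->
  (forall j t, q j t != 0 -> `|c 0 j - t| <= r) ->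
  (forall j t, `|q j t| <= 1) ->
  \int[mu]_x (prod_fun q x * difference_defect h x) = 0.
Proof.
move=> /andP[h0 hr] cO sq qr q1.
have s1 : `|s| = 1.
  by apply/eqP; rewrite -sqrp_eq1// -normrX expr2 ss normr1.
have r0 : 0 <= r by apply: le_trans hr; exact: ltW.
have cq j : continuous (q j) by exact: smooth1_continuous.
have [B dB] : exists B : R -> R, forall t : R, is_derive t 1 B (q i t).
  apply: (@antiderivative_exists _ (c 0 i - r) (c 0 i + r)) => // t /qr.
  by rewrite ler_distl => /andP[? ?]; apply/andP; split; lra.
have sB : smooth1 B by apply: (smooth1_antiderivative dB); exact: sq.
(* [rho] replaces the [i]-th factor: it is the integral of [q i] over a segment
   of length [h], hence smooth with a derivative that is a difference. *)
pose rho := cst s \* (B \+ (cst (-1) \* (fun t => B (1 * t + - (s * h))))).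
have rhoE t : rho t = s * (B t - B (t - s * h)).
  by rewrite /rho/= mul1r mulN1r.
have srho : smooth1 rho.
  apply: smooth1M; first exact: smooth1_cst.
  apply: smooth1D => //; apply: smooth1M; first exact: smooth1_cst.
  exact: smooth1_affine.
pose phi := prod_fun (replace q i rho).
have bcont : continuous (prod_fun q) by exact: continuous_prod_fun.
have mb : measurable_fun setT (prod_fun q) by exact: continuous_measurable_rV.
have b1 x : `|prod_fun q x| <= 1.
  rewrite /prod_fun normr_prod; apply: prodr_ile1 => j _.
  by rewrite normr_ge0 q1.
have dE x t : (x - t *: d) 0 i = x 0 i - s * t.
  by rewrite !mxE !eqxx mulr1 mulrC.
have dE' x t j : j != i -> (x - t *: d) 0 j = x 0 j.
  by move=> /negbTE ji; rewrite !mxE ji andbF !mulr0 subr0.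
have bE x t : prod_fun q (x - t *: d) =
    q i (x 0 i - s * t) * \prod_(j | j != i) q j (x 0 j).
  rewrite (prod_funD1 q i) dE; congr (_ * _).
  by apply: eq_bigr => j ji; rewrite dE'.
have cq' (y : R) : continuous (fun t => q i (y - s * t)).
  move=> t; apply: (@continuous_comp _ _ _ (fun t : R => y - s * t) (q i)); last exact: cq.
  by apply: cvgB; [exact: cvg_cst|apply: cvgM; [exact: cvg_cst|exact: cvg_id]].
have rhoI y : rho y = \int[lambda]_(t in `[0, h]) q i (y - s * t).
  by rewrite rhoE (integral_derivative y h0 ss (cq i) dB).
have phiE x : phi x = segint (prod_fun q) (- d) h x.
  rewrite /phi prod_funE rhoI /segint.
  under [RHS]eq_Rintegral do rewrite scalerN bE.
  rewrite RintegralZr//.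
  apply: continuous_compact_integrable; first exact: segment_compact.
  exact: continuous_subspaceT.
have dphi x : partial i phi x = s * (prod_fun q x - prod_fun q (x - h *: d)).
  have drho (t : R) : is_derive t 1 rho (s * (q i t - q i (t - s * h))).
    have dBh : is_derive t 1 (fun t => B (t - s * h)) (q i (t - s * h)).
      have dsh : is_derive t 1 (fun t : R => t - s * h) 1.
        by have := is_derive_shift t 1 (- (s * h)); exact.
      have := @is_derive1_comp R B (fun t => t - s * h) t _ _ (dB _) dsh.
      by rewrite mulr1.
    have -> : rho = (s *: (B - (fun t => B (t - s * h))) : R -> R).
      by apply/funext => y; rewrite rhoE.
    by apply: is_deriveZ; exact: is_deriveB.
  have := @is_derive_prod_fun R n (replace q i rho) i x
    (s * (q i (x 0 i) - q i (x 0 i - s * h))).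
  rewrite /replace eqxx => /(_ (drho _)) dp.
  rewrite /partial /phi derive_val bE (prod_funD1 q i x).
  rewrite -mulrA mulrBl; congr (_ * (_ * _ - _ * _)).
    by apply: eq_bigr => j /negbTE ->.
  by apply: eq_bigr => j /negbTE ->.
have tphi : test_function Omega phi.
  apply: (@test_function_prod_fun _ _ _ _ c (2 * r)) => //.
  - by rewrite mulr_ge0.
  - by move=> j; rewrite /replace; case: ifP.
  - move=> j t; rewrite /replace; case: (eqVneq j i) => [->|_]; last first.
      by move=> /qr /le_trans; apply; rewrite ler_peMl// ler1n.
    apply: contraNT; rewrite -ltNge => rt; apply/eqP; rewrite rhoI.
    rewrite (@eq_Rintegral _ _ _ _ _ (cst 0)); first by rewrite Rintegral_cst// mul0r.
    move=> u; rewrite inE/= in_itv/= => /andP[u0 uh].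
    have [->//|/qr cu] := eqVneq (q i (t - s * u)) 0; exfalso.
    have su : `|s * u| <= r by rewrite normrM s1 mul1r ger0_norm// (le_trans uh).
    have := ler_normB (c 0 i - (t - s * u)) (s * u).
    rewrite (_ : _ - _ - _ = c 0 i - t); last by ring.
    lra.
have := weak tphi.
have -> : \int[mu]_x (G x * phi x) = \int[mu]_x (prod_fun q x * segint G d h x).
  by rewrite -(integral_segint_adjoint d h iG mb b1); apply: eq_Rintegral => x _; rewrite phiE.
have ibW := integrable_bounded iW mb b1.
have mbh : measurable_fun setT (fun x : 'rV[R]_n.+1 => prod_fun q (x - h *: d)).
  by apply: measurableT_comp => //; exact: measurable_translation.
have ibWh : mu.-integrable setT (EFin \o (fun x : 'rV[R]_n.+1 => W x * prod_fun q (x - h *: d))).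
  by apply: (integrable_bounded iW mbh) => x; exact: b1.
have iWh : mu.-integrable setT (EFin \o (fun x : 'rV[R]_n.+1 => W (x + h *: d))).
  exact: (integrable_translation (h *: d) iW).
have ibWh' := integrable_bounded iWh mb b1.
have -> : \int[mu]_x (W x * partial i phi x) =
    s * (\int[mu]_x (W x * prod_fun q x) -
         \int[mu]_x (W (x + h *: d) * prod_fun q x)).
  transitivity (\int[mu]_x (s * (W x * prod_fun q x - W x * prod_fun q (x - h *: d)))).
    by apply: eq_Rintegral => x _; rewrite dphi; ring.
  rewrite RintegralZl//; last exact: (integrableB measurableT ibW ibWh).
  rewrite RintegralB//; congr (_ * (_ - _)); rewrite /Rintegral; congr fine.
  rewrite -(integral_translation (h *: d) ibWh); apply: eq_integral => x _ /=.
  by rewrite addrK.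
have ibS := integrable_bounded (integrable_segint d h iG) mb b1.
move=> wE.
transitivity (\int[mu]_x ((W (x + h *: d) * prod_fun q x - W x * prod_fun q x)
   - s * (segint G d h x * prod_fun q x))).
  by apply: eq_Rintegral => x _; rewrite /difference_defect; ring.
rewrite RintegralB//; last 2 first.
- exact: (integrableB measurableT ibWh' ibW).
- exact: (integrableZl measurableT s ibS).
rewrite RintegralB// RintegralZl//.
under [X in _ - s * X]eq_Rintegral do rewrite mulrC.
move: wE; set I1 := \int[mu]_x _; set I2 := \int[mu]_x _; set I3 := \int[mu]_x _.
by move=> /(congr1 (fun z => - s * z)); rewrite mulNr mulrA ss mul1r mulrNN; lra.
Qed.

End signed_direction.

End difference_identity.

(** * The difference identity almost everywhere *)

Section real_dominated_convergence.
Context d (T : measurableType d) (R : realType).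
Variable mu : {measure set T -> \bar R}.

Lemma Rintegral_dominated_cvg (u_ : nat -> T -> R) (u g : T -> R) :
  (forall k, measurable_fun setT (u_ k)) -> measurable_fun setT u ->
  {ae mu, forall x, u_ k x @[k --> \oo] --> u x} ->
  mu.-integrable setT (EFin \o g) ->
  {ae mu, forall x, forall k, `|u_ k x| <= g x} ->
  \int[mu]_x u_ k x @[k --> \oo] --> \int[mu]_x u x.
Proof.
move=> mu_ mu1 cu ig ug.
have [] := @dominated_convergence _ _ _ mu setT measurableT
  (fun k x => (u_ k x)%:E) (EFin \o u) (EFin \o g).
- by move=> k; apply/measurable_EFinP.
- exact/measurable_EFinP.
- by apply: filterS cu => x ux _; apply: cvg_EFin; [exact: nearW|exact: ux].
- by [].
- by apply: filterS ug => x ux k _; rewrite lee_fin.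
move=> iu _ cv; apply: fine_cvg; rewrite fineK//.
exact: integrable_fin_num.
Qed.

End real_dominated_convergence.

Section local_difference_identity.
Context (R : realType) (n : nat).
Local Notation mu := (lebesgue_rV R n.+1).

(** A smooth approximation of the indicator function of [`]a, b[]. *)
Definition bump (a b : R) (k : nat) (t : R) : R :=
  flat 1 (k.+1%:R * (t - a)) * flat 1 (k.+1%:R * (b - t)).

Lemma smooth1_bump a b k : smooth1 (bump a b k).
Proof.
have -> : bump a b k = (fun t => flat 1 (k.+1%:R * t + - (k.+1%:R * a)))
    \* (fun t => flat 1 (- k.+1%:R * t + k.+1%:R * b)).
  by apply/funext => t; rewrite /bump/=; congr (flat 1 _ * flat 1 _); ring.
by apply: smooth1M; apply: smooth1_affine; exact: smooth1_flat.
Qed.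

Lemma bump_neq0 a b k t : bump a b k t != 0 -> a < t < b.
Proof.
rewrite /bump mulf_eq0 negb_or /flat.
case: ifPn; last by rewrite eqxx.
case: ifPn; last by rewrite eqxx andbF.
by rewrite !pmulr_rgt0 ?ltr0n// !subr_gt0 => -> ->.
Qed.

Lemma bump_ge0_le1 a b k t : 0 <= bump a b k t <= 1.
Proof.
by rewrite mulr_ge0 ?flat_ge0//= mulr_ile1 ?flat_ge0 ?flat_le1.
Qed.

Lemma cvg_flat (u : R) : 0 < u -> flat 1 (k.+1%:R * u) @[k --> \oo] --> (1 : R).
Proof.
move=> u0.
rewrite (_ : (fun k => _) = (fun k => expR (- (k.+1%:R^-1 * u^-1)))); last first.
  apply/funext => k; rewrite /flat pmulr_rgt0 ?ltr0n// u0 hornerC mul1r.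
  by rewrite invfM.
have cv : - (k.+1%:R^-1 * u^-1) @[k --> \oo] --> (0 : R).
  rewrite -[X in _ --> X]oppr0 -[X in _ --> - X](mul0r u^-1).
  by apply: cvgN; apply: cvgM; [exact: cvg_harmonic|exact: cvg_cst].
by rewrite -[X in _ --> X]expR0; apply: continuous_cvg cv; exact: continuous_expR.
Qed.

Lemma cvg_bump (a b t : R) :
  bump a b k t @[k --> \oo] --> ((a < t < b)%R%:R : R).
Proof.
have [atb|] := boolP (a < t < b).
  rewrite -[X in _ --> X](mulr1 (1 : R)); case/andP: atb => a_t t_b.
  by apply: cvgM; apply: cvg_flat; rewrite subr_gt0.
move=> atb; rewrite (_ : (fun k => _) = cst 0); first exact: cvg_cst.
by apply/funext => k; apply/eqP; apply: contraNT atb => /bump_neq0.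
Qed.

Lemma cvg_prod_ord (I : Type) (s : seq I) (u : I -> nat -> R) (l : I -> R) :
  (forall i, u i k @[k --> \oo] --> l i) ->
  \prod_(i <- s) u i k @[k --> \oo] --> \prod_(i <- s) l i.
Proof.
move=> ul; elim: s => [|i s IH].
  rewrite big_nil (_ : (fun k => _) = cst 1); first exact: cvg_cst.
  by apply/funext => k; rewrite big_nil.
rewrite big_cons (_ : (fun k => _) = (fun k => u i k * \prod_(j <- s) u j k)).
  by apply: cvgM.
by apply/funext => k; rewrite big_cons.
Qed.

Variables (Omega : set 'rV[R]_n.+1) (W G : 'rV[R]_n.+1 -> R).
Hypothesis iW : mu.-integrable setT (EFin \o W).
Hypothesis iG : mu.-integrable setT (EFin \o G).
Variable i : 'I_n.+1.
Hypothesis weak : forall phi, test_function Omega phi ->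
  \int[mu]_x (W x * partial i phi x) = - \int[mu]_x (G x * phi x).
Variable s : R.
Hypothesis ss : s * s = 1.
Let d : 'rV[R]_n.+1 := s *: delta_mx ord0 i.

(** Bumps converge boundedly to the indicators of the boxes cut out of a ball
    by orthants, so that the integrals of the defect over these boxes vanish,
    and therefore the defect itself. The ball of radius [2 r] leaves room for
    the supports of the test functions. *)
Lemma difference_identity_local (c : 'rV[R]_n.+1) (r h : R) :
  0 < h <= r -> [set x : 'rV[R]_n.+1 | `|c - x| <= 2 * r] `<=` Omega ->
  {ae mu, forall x, ball c r x -> W (x + h *: d) - W x = s * segint G d h x}.
Proof.
move=> hr cO; pose K := difference_defect W G i s h.
have iK : mu.-integrable setT (EFin \o K).
  exact: integrable_difference_defect.
have mK : measurable_fun setT K by apply/measurable_EFinP; exact: measurable_int iK.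
have r0 : 0 < r by case/andP: hr => h0; exact: lt_le_trans.
have mb : measurable (ball c r) by exact: measurable_rV_ball.
have iKb : mu.-integrable setT ((EFin \o K) \_ (ball c r)).
  exact: (integrable_mkcond (EFin \o K) mb).1 (integrableS measurableT mb (@subsetT _ _) iK).
have Kb a : (\int[mu]_(x in orthant a `&` ball c r) (K x)%:E = 0)%E.
  (* The orthant meets the ball in the box of sides [`]lo j, c_j + r[]. *)
  pose lo j := Num.max (a 0 j) (c 0 j - r).
  pose q k j := bump (lo j) (c 0 j + r) k.
  pose D := orthant a `&` ball c r.
  have mD : measurable D by apply: measurableI => //; exact: measurable_orthant.
  have q0 k : \int[mu]_x (prod_fun (q k) x * K x) = 0.
    apply: (difference_defect_bump iW iG weak ss hr cO).
    - by move=> j; exact: smooth1_bump.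
    - move=> j t /bump_neq0; rewrite /lo gt_max ler_distl.
      by move=> /andP[/andP[_ ?] ?]; apply/andP; split; lra.
    - move=> j t; have /andP[? ?] := bump_ge0_le1 (lo j) (c 0 j + r) k t.
      by rewrite ger0_norm.
  have DE (x : 'rV[R]_n.+1) : \prod_j ((lo j < x 0 j < c 0 j + r)%R%:R : R) = \1_D x.
    rewrite indicE; have [xD|xD] := boolP (x \in D).
      rewrite big1// => j _; have [ax [_ cx]] : D x by rewrite inE in xD.
      have := cx 0 j; rewrite /ball/= ltr_distlC => /andP[x1 x2].
      by rewrite /lo gt_max ax x1 x2.
    apply/eqP; rewrite prodf_seq_eq0; apply: contraNT xD => /hasPn xD.
    have xj j : lo j < x 0 j < c 0 j + r.
      have := xD j (mem_index_enum _); rewrite /=.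
      by case: ltP => // _; case: ltP => //; rewrite /= ?eqxx.
    rewrite inE; split => [j|].
      by have := xj j; rewrite /lo gt_max => /andP[/andP[]].
    split => // u j; rewrite (ord1 u) /ball/= ltr_distlC.
    by have := xj j; rewrite /lo gt_max => /andP[/andP[_ ->] ->].
  have cv : \int[mu]_x (prod_fun (q k) x * K x) @[k --> \oo] -->
      \int[mu]_x (\1_D x * K x).
    apply: (@Rintegral_dominated_cvg _ _ _ mu _ _ (fun x => `|K x|)).
    - move=> k; apply: measurable_funM => //; apply: continuous_measurable_rV.
      by apply: continuous_prod_fun => j; apply: smooth1_continuous; exact: smooth1_bump.
    - by apply: measurable_funM => //; exact: measurable_indic.
    - apply: aeW => x; apply: cvgM; last exact: cvg_cst.
      by rewrite -DE; apply: cvg_prod_ord => j; exact: cvg_bump.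
    - exact: integrable_abse iK.
    - apply: aeW => x k; rewrite normrM ler_piMl//.
      rewrite /prod_fun normr_prod; apply: prodr_ile1 => j _.
      have /andP[? ?] := bump_ge0_le1 (lo j) (c 0 j + r) k (x 0 j).
      by rewrite ger0_norm//; apply/andP.
  have D0 : \int[mu]_x (\1_D x * K x) = 0.
    apply/esym; apply: (cvg_unique _ _ cv) => //.
    rewrite (_ : (fun k => _) = cst 0); first exact: cvg_cst.
    by apply/funext => k; exact: q0.
  have iD : mu.-integrable D (EFin \o K).
    exact: (integrableS measurableT mD (@subsetT _ _) iK).
  rewrite -[LHS]fineK; last exact: integrable_fin_num.
  congr EFin; rewrite -[RHS]D0 -/(Rintegral mu D K) Rintegral_mkcond.
  apply: eq_Rintegral => x _; rewrite patchE indicE.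
  by case: ifPn => _; rewrite ?mul1r ?mul0r.
have : {ae mu, forall x, ((EFin \o K) \_ (ball c r)) x = 0%E}.
  apply: integral_orthant_eq0 => //.
    rewrite -integral_mkcond -(Kb (\row_j (c 0 j - r))).
    congr (integral _ _ _); rewrite setIidr// => x [_ cx] j; rewrite mxE.
    by have := cx 0 j; rewrite /ball/= ltr_distlC => /andP[].
  by move=> a; rewrite -integral_mkcondr.
apply: filterS => x; rewrite patchE => + cx; rewrite mem_set//= => -[].
by rewrite /K /difference_defect => /eqP; rewrite subr_eq0 => /eqP.
Qed.

End local_difference_identity.

(** * Lebesgue differentiation along segments *)

Section differentiation_along_segments.
Context (R : realType).
Local Notation lambda := (@lebesgue_measure R).

Let measurable_shift (c : R) : measurable_fun setT
  ((fun t => t + c) : measurableTypeR R -> measurableTypeR R).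
Proof. exact: measurable_funD. Qed.

Let push_shift (c : R) (A : set (measurableTypeR R)) :
  measurable A -> A `<=` setT ->
  pushforward lambda
    ((fun t => t + c) : measurableTypeR R -> measurableTypeR R) A = lambda A.
Proof. by move=> mA _; exact: lebesgue_measureD. Qed.

Lemma lebesgue_integrableD (c : R) (g : R -> \bar R) :
  lambda.-integrable setT (g : measurableTypeR R -> \bar R) ->
  lambda.-integrable setT ((fun t => g (t + c)) : measurableTypeR R -> \bar R).
Proof.
move=> ig; have mg := measurable_int _ ig; have mc := measurable_shift c.
apply/integrableP; split; first exact: (measurableT_comp mg mc).
have /integrableP[_] := ig; apply: le_lt_trans.
rewrite le_eqVlt; apply/orP; left; apply/eqP.
transitivity (\int[pushforward lambda
  ((fun t => (t + c)%R) : measurableTypeR R -> measurableTypeR R)]_t `|g t|)%E.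
  rewrite ge0_integral_pushforward//; exact: measurableT_comp.
by apply: eq_measure_integral; exact: push_shift.
Qed.

Lemma lebesgue_integralD (c : R) (g : R -> \bar R) :
  lambda.-integrable setT (g : measurableTypeR R -> \bar R) ->
  (\int[lambda]_t g (t + c)%R = \int[lambda]_t g t)%E.
Proof.
move=> ig; have mg := measurable_int _ ig; have mc := measurable_shift c.
transitivity (\int[pushforward lambda
  ((fun t => (t + c)%R) : measurableTypeR R -> measurableTypeR R)]_t g t)%E.
  by rewrite integral_pushforward//; exact: lebesgue_integrableD.
by apply: eq_measure_integral; exact: push_shift.
Qed.

Lemma Rintegral_itvD (psi : R -> R) (t h : R) :
  lambda.-integrable setT (EFin \o psi : measurableTypeR R -> \bar R) ->
  \int[lambda]_(v in `]t, (t + h)]) psi v =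
  \int[lambda]_(v in `[0, h]) psi (t + v).
Proof.
move=> ipsi; pose g := (EFin \o psi) \_ `]t, (t + h)]%classic.
have ig : lambda.-integrable setT (g : measurableTypeR R -> \bar R).
  have mI : measurable (`]t, (t + h)]%classic : set (measurableTypeR R)).
    exact: measurable_itv.
  apply: (integrable_mkcond (mu := lambda) (EFin \o psi) mI).1.
  exact: (integrableS measurableT mI (@subsetT _ _) ipsi).
have itpsi : lambda.-integrable setT
    (EFin \o (fun v => psi (t + v)) : measurableTypeR R -> \bar R).
  have := lebesgue_integrableD t ipsi; apply: eq_integrable => // v _ /=.
  by rewrite addrC.
transitivity (\int[lambda]_(v in `]0, h]) psi (t + v)).
  rewrite /Rintegral integral_mkcond -/g; congr fine.
  rewrite -(lebesgue_integralD t ig) [RHS]integral_mkcond.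
  apply: eq_integral => v _; rewrite /g !patchE.
  rewrite (_ : (v + t \in _) = (v \in `]0, h]%classic)); last first.
    by apply/idP/idP; rewrite !inE/= !in_itv/= ltrDr [t + h]addrC lerD2r.
  by case: ifPn => // _; rewrite /= addrC.
rewrite Rintegral_itv_obnd_cbnd//.
have mI : measurable (`]0, h]%classic : set (measurableTypeR R)).
  exact: measurable_itv.
exact: (integrableS measurableT mI (@subsetT _ _) itpsi).
Qed.

Lemma lebesgue_differentiation_right (psi : R -> R) :
  lambda.-integrable setT (EFin \o psi : measurableTypeR R -> \bar R) ->
  {ae lambda, forall t, k.+1%:R *
    \int[lambda]_(v in `[0, k.+1%:R^-1]) psi (t + v) @[k --> \oo] --> psi t}.
Proof.
move=> ipsi.
have loc : locally_integrable [set: R] psi.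
  by apply: open_integrable_locally => //; exact: openT.
have iy (y : R) : lambda.-integrable `]-oo, y] (EFin \o psi).
  have mI : measurable (`]-oo, y]%classic : set (measurableTypeR R)).
    exact: measurable_itv.
  exact: (integrableS measurableT mI (@subsetT _ _) ipsi).
have := FTC1Ny iy loc.
apply: filterS; first exact: (ae_filter_ringOfSetsType lambda).
move=> t [] /cvg_ex[/= l dF] F'.
have {F'} lE : l = psi t.
  by rewrite -F' derive1E; apply/esym/cvg_lim.
rewrite -lE; move/cvg_dnbhs_at_right/cvg_at_rightP : dF.
move=> /(_ (fun k => k.+1%:R^-1)).
have hk : (forall k, 0 < k.+1%:R^-1 :> R) /\
    (k.+1%:R^-1 @[k --> \oo] --> (0 : R)).
  by split=> [k|]; [rewrite invr_gt0 ltr0n|exact: cvg_harmonic].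
move=> /(_ hk) cv; apply: cvg_trans cv; apply: near_eq_cvg; apply: nearW => k.
rewrite invrK /GRing.scale/= mulr1 -Rintegral_itvD//; congr (_ * _).
rewrite [_ + t]addrC (@Rintegral_itvB _ _ -oo%O)//.
by rewrite bnd_simp lerDl invr_ge0.
Qed.

Context (n : nat).
Local Notation mu := (lebesgue_rV R n).
Implicit Types (x d : 'rV[R]_n).

Lemma measurable_not_cvg (u_ : nat -> 'rV[R]_n -> R) (u : 'rV[R]_n -> R) :
  (forall k, measurable_fun setT (u_ k)) -> measurable_fun setT u ->
  measurable [set x | ~ (u_ k x @[k --> \oo] --> u x)].
Proof.
move=> mu_ mu1.
pose v x := limn_esup (fun k => `|u_ k x - u x|%:E).
have mv : measurable_fun setT v.
  apply: measurable_fun_limn_esup => k; apply/measurable_EFinP.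
  by apply: measurableT_comp => //; exact: measurable_funB.
rewrite (_ : [set x | _] = ~` (v @^-1` [set 0%E])).
  by apply: measurableC; rewrite -[X in measurable X]setTI; exact: mv.
congr (~` _); apply/seteqP; split => x /= => [ux|v0].
  have ux0 : `|u_ k x - u x| @[k --> \oo] --> (0 : R).
    by rewrite -(normr0 R); apply: cvg_norm; apply/subr_cvg0.
  have ux0e : `|u_ k x - u x|%:E @[k --> \oo] --> 0%E.
    by apply: cvg_EFin; [exact: nearW|exact: ux0].
  by rewrite /v is_cvg_limn_esupE; [exact/cvg_lim|apply/cvg_ex; exists 0%E].
have := @limn_esup_le_cvg R (fun k => `|u_ k x - u x|%:E) 0%E.
rewrite -/(v x) v0 lexx => /(_ isT) cv.
have {cv} : `|u_ k x - u x|%:E @[k --> \oo] --> 0%E by apply: cv => k; rewrite lee_fin.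
by move=> /fine_cvgP[_] /= /norm_cvg0P /subr_cvg0.
Qed.

(** Almost every point is the limit of the averages over short segments which
    start there: the one-dimensional statement holds on almost every line, and
    translations along the line preserve the null sets. *)
Lemma segint_cvg (g : 'rV[R]_n -> R) d : mu.-integrable setT (EFin \o g) ->
  {ae mu, forall x, k.+1%:R * segint g d k.+1%:R^-1 x @[k --> \oo] --> g x}.
Proof.
move=> ig; have mg : measurable_fun setT g.
  by apply/measurable_EFinP; exact: measurable_int ig.
pose u_ k x := k.+1%:R * segint g d k.+1%:R^-1 x.
pose bad := [set x | ~ (u_ k x @[k --> \oo] --> g x)].
have mbad : measurable bad.
  apply: measurable_not_cvg => // k; apply: measurable_funM => //.
  by apply/measurable_EFinP; exact: measurable_int (integrable_segint d _ ig).
suff bad0 : mu bad = 0%E by exists bad; split.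
have it := integrable_shear d (@integrable_tensor_itv R n 0 2 1 g (cst 1) ig
  (measurable_cst _) (fun=> ltac:(by rewrite normr1))).
(* The interval [`]0, 1[] of parameters suffices: the segments which start in it
   stay in [`[0, 2]], where the restriction of [g] to almost every line is
   integrable. *)
have line : {ae mu, forall x, {ae lambda, forall t : R,
    0 < t < 1 -> ~ bad (x + t *: d)}}.
  apply: filterS (ae_integrable1 it) => x ix.
  pose psi (t : R) := g (x + t *: d) * \1_`[0, 2] t.
  have ipsi : lambda.-integrable setT
      (EFin \o psi : measurableTypeR R -> \bar R).
    by apply: eq_integrable ix => // t _; rewrite /shear/= mulr1.
  have := lebesgue_differentiation_right ipsi.
  apply: filterS; first exact: (ae_filter_ringOfSetsType lambda).
  move=> t tcv /andP[t0 t1].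
  apply; move: tcv; rewrite {2}/psi indicE mem_set/=; last first.
    by rewrite in_itv/= (ltW t0)/= (le_trans (ltW t1))// ler1n.
  rewrite mulr1 => tcv; apply: cvg_trans tcv.
  apply: near_eq_cvg; apply: nearW => k.
  rewrite /u_ /segint; congr (_ * _); apply: eq_Rintegral => v.
  rewrite inE/= in_itv/= => /andP[v0 v1]; rewrite /psi indicE mem_set/=.
    by rewrite mulr1 scalerDl addrA.
  rewrite in_itv/= addr_ge0 ?(ltW t0)//=.
  have : v <= 1 by rewrite (le_trans v1)// invf_le1 ?ltr0n// ler1n.
  by move: t1; lra.
(* The bad set meets almost every line in a null set; by Fubini and the
   invariance under translations it is null. *)
pose ind (p : 'rV[R]_n * measurableTypeR R) : \bar R :=
  (\1_bad (p.1 + (p.2 : R) *: d) * \1_`]0, 1[ (p.2 : R))%:E.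
have mind : measurable_fun setT ind.
  apply/measurable_EFinP; apply: measurable_funM.
    apply: (measurableT_comp (f := \1_bad : 'rV[R]_n -> R)).
      exact: measurable_indic.
    exact: (measurableT_comp measurable_fst (measurable_shear d)).
  apply: (measurableT_comp (f := \1_(`]0, 1[%classic) : measurableTypeR R -> R)).
    exact: measurable_indic.
  exact: measurable_snd.
have ind0 p : (0 <= ind p)%E by rewrite lee_fin mulr_ge0.
have := fubini_tonelli (m1 := mu) (m2 := lambda) ind mind ind0.
have -> : (\int[mu]_x \int[lambda]_t ind (x, t) = 0)%E.
  rewrite (eq_integral_ae (g := cst 0%E)) ?integral0//.
  apply: filterS line => x xl _.
  rewrite (eq_integral_ae (g := cst 0%E)) ?integral0//.
  move: xl; apply: filterS; first exact: (ae_filter_ringOfSetsType lambda).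
  move=> t tb _; rewrite /ind/= !indicE.
  have [tI|tI] := boolP (t \in `]0, 1[%classic); last by rewrite mulr0.
  have [xb|xb] := boolP (x + (t : R) *: d \in bad); last by rewrite mul0r.
  by exfalso; apply: tb; [move: tI|move: xb]; rewrite inE//= in_itv.
have -> : (\int[lambda]_t \int[mu]_x ind (x, t) =
    \int[lambda]_t (mu bad * (\1_`]0%R, 1%R[ (t : R))%:E))%E.
  apply: eq_integral => t _; rewrite /ind/=.
  under eq_integral do rewrite EFinM muleC.
  rewrite ge0_integralZl//.
  - rewrite muleC; congr (_ * _)%E.
    rewrite (ge0_integral_translation ((t : R) *: d)
      (g := fun x => (\1_bad x)%:E))//.
      by rewrite integral_indic// setIT.
    by apply/measurable_EFinP; exact: measurable_indic.
  - apply/measurable_EFinP; apply: (measurableT_comp (f := \1_bad : 'rV[R]_n -> R)).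
      exact: measurable_indic.
    exact: measurable_translation.
rewrite ge0_integralZl//; last first.
  by apply/measurable_EFinP; exact: measurable_indic.
have l1 : lambda (`]0%R, 1%R[%classic : set R) = 1%E.
  by rewrite lebesgue_measure_itv/= lte_fin ltr01 oppr0 addr0.
by rewrite integral_indic// setIT [X in (_ * X)%E]l1 mule1 => /esym.
Qed.

End differentiation_along_segments.

(** * Weak derivatives as limits of difference quotients *)

Section weak_derivative_quotients.
Context (R : realType) (n : nat).
Local Notation mu := (lebesgue_rV R n.+1).

Lemma cvg_shift_harmonic (x d : 'rV[R]_n.+1) :
  x + k.+1%:R^-1 *: d @[k --> \oo] --> x.
Proof.
have : x + k.+1%:R^-1 *: d @[k --> \oo] --> x + 0 *: d.
  apply: cvgD; first exact: cvg_cst.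
  by apply: cvgZr_tmp; exact: cvg_harmonic.
by rewrite scale0r addr0.
Qed.

(** A weak derivative [G] of [W] in an open set is almost everywhere the limit
    of the difference quotients of [W], on either side ([s = 1] or [s = -1]). *)
Lemma weak_quotient_cvg (Omega : set 'rV[R]_n.+1) (W G : 'rV[R]_n.+1 -> R)
    (i : 'I_n.+1) (s : R) : open Omega ->
  mu.-integrable setT (EFin \o W) -> mu.-integrable setT (EFin \o G) ->
  (forall phi, test_function Omega phi ->
    \int[mu]_x (W x * partial i phi x) = - \int[mu]_x (G x * phi x)) ->
  s * s = 1 ->
  {ae mu, forall x, Omega x ->
    k.+1%:R * (W (x + k.+1%:R^-1 *: (s *: delta_mx ord0 i)) - W x)
      @[k --> \oo] --> s * G x}.
Proof.
move=> oO iW iG weak ss; set d := s *: _.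
pose P x := k.+1%:R * (W (x + k.+1%:R^-1 *: d) - W x) @[k --> \oo] --> s * G x.
(* The statement is local: it is proved on each of the countably many rational
   balls whose threefold dilation lies in [Omega]. *)
pose F (q : 'rV[rat]_n.+1 * nat) :=
  if `[<ball (rat_point R q.1) (3 * q.2.+1%:R^-1) `<=` Omega>]
  then [set x | @rat_ball R _ q x /\ ~ P x] else set0.
apply: (@negligibleS _ _ _ _ (\bigcup_q F q)).
  move=> x /= /not_implyP[Ox nP].
  have [q qx qO] := @rat_ball_nbhs R _ Omega x 3 ltac:(lra) oO Ox.
  by exists q => //; rewrite /F; case: asboolP.
apply: negligible_bigcup_countable => -[c m]; rewrite /F.
case: asboolP => [/= cO|_]; last exact: negligible_set0.
set r : R := m.+1%:R^-1 in cO.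
have r0 : 0 < r by rewrite invr_gt0 ltr0n.
have cO2 : [set x : 'rV[R]_n.+1 | `|rat_point R c - x| <= 2 * r] `<=` Omega.
  move=> x /= cx; apply: cO; rewrite -ball_normE /ball_/=.
  by apply: le_lt_trans cx _; rewrite ltr_pM2r// ltr_nat.
have idk : {ae mu, forall x, forall k : nat, k.+1%:R^-1 <= r ->
    ball (rat_point R c) r x ->
    W (x + k.+1%:R^-1 *: d) - W x = s * segint G d k.+1%:R^-1 x}.
  apply: ae_foralln => k; have [kr|kr] := leP k.+1%:R^-1 r; last exact: aeW.
  have k0 : 0 < (k.+1%:R^-1 : R) <= r.
    by apply/andP; split => //; rewrite invr_gt0 ltr0n.
  have := difference_identity_local iW iG weak ss k0 cO2.
  by apply: filterS => x + _; exact.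
have : {ae mu, forall x, rat_ball (c, m) x -> P x}.
  apply: filterS2 idk (segint_cvg d iG) => x idx cvx cx.
  rewrite /P.
  have : k.+1%:R * (s * segint G d k.+1%:R^-1 x) @[k --> \oo] --> s * G x.
    under eq_fun do rewrite mulrCA.
    by apply: cvgM => //; exact: cvg_cst.
  apply: cvg_trans; apply: near_eq_cvg; near=> k; rewrite idx//.
  by near: k; have := near_infty_natSinv_lt (PosNum r0); apply: filterS => k /ltW.
by apply: negligibleS => x /= [cx nP] h; exact/nP/h.
Unshelve. all: by end_near. Qed.

End weak_derivative_quotients.

Section degenerate_sobolev.
Context (R : realType) (n : nat).
Local Notation mu := (lebesgue_rV R n.+1).
Variables (Omega : set 'rV[R]_n.+1) (f : R -> R).
Hypothesis oO : open Omega.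
Hypothesis bO : bounded_set Omega.
Hypothesis cf : continuous f.
Hypothesis n0 : (0 < n)%N.

Let mO : measurable Omega. Proof. exact: open_measurable_rV. Qed.

Lemma bounded_lebesgue_lty : (mu Omega < +oo)%E.
Proof.
have [r r0 Or] := bounded_subset_ball bO.
apply: le_lt_trans (lebesgue_rV_ball_lty 0 r); apply: le_measure; rewrite ?inE//.
exact: measurable_rV_ball.
Qed.

(** A function in [L2 Omega] agrees almost everywhere in [Omega] with a
    function which is Borel, integrable and zero outside [Omega]. *)
Lemma L2_representative v : L2 Omega v -> exists V : 'rV[R]_n.+1 -> R,
  [/\ measurable_fun setT V, mu.-integrable setT (EFin \o V),
    mu.-integrable setT (EFin \o (fun x => V x ^+ 2)),
    forall x, ~ Omega x -> V x = 0 & v = V %[ae mu in Omega]].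
Proof.
move=> [[h mh vh] v2]; pose V := h \_ Omega.
have mV : measurable_fun setT V := ((measurable_restrictT h mO).1 mh).
have vV : v = V %[ae mu in Omega].
  by apply: filterS vh => x + Ox => ->//; rewrite /V patchE mem_set.
have VO x : ~ Omega x -> V x = 0 by move=> Ox; rewrite /V patchE memNset.
have mV2 : measurable_fun setT (fun x => V x ^+ 2) by exact: measurable_funX.
have iV2 : mu.-integrable setT (EFin \o (fun x => V x ^+ 2)).
  apply/integrableP; split; first exact/measurable_EFinP.
  apply: le_lt_trans v2; rewrite [leRHS]integral_mkcond.
  apply: ge0_le_integral_ae => [x _|x _|].
  - by [].
  - by rewrite patchE; case: ifPn => // _; rewrite lee_fin sqr_ge0.
  - apply: filterS vV => x vVx _; rewrite patchE; case: ifPn => [|].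
      by rewrite inE => /vVx ->; rewrite /= ger0_norm ?sqr_ge0.
    by rewrite notin_setE => /VO /= ->; rewrite expr0n/= normr0.
exists V; split => //.
have i1 : mu.-integrable setT (EFin \o \1_Omega).
  apply/integrableP; split; first by apply/measurable_EFinP; exact: measurable_indic.
  rewrite (eq_integral (fun x => (\1_Omega x)%:E)); last first.
    by move=> x _; rewrite /= ger0_norm.
  by rewrite integral_indic// setIT; exact: bounded_lebesgue_lty.
have := integrableD measurableT i1 iV2 => i2.
apply: (le_integrable _ _ _ i2) => //; first exact/measurable_EFinP.
move=> x _ /=; rewrite lee_fin [leRHS]ger0_norm; last first.
  by rewrite addr_ge0// sqr_ge0.
rewrite indicE; have [Ox|] := boolP (x \in Omega).
  rewrite mulr1n -[V x ^+ 2]real_normK ?num_real//.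
  by move: `|V x| (normr_ge0 (V x)) (sqr_ge0 (`|V x| - 1)) => y; nra.
by rewrite notin_setE => /VO ->; rewrite normr0 expr0n/= addr0.
Qed.

Lemma continuous_weight i : continuous (fun x : 'rV[R]_n.+1 => weight f x i).
Proof.
rewrite /weight; case: (i == ord_max) => /=; last exact: cst_continuous.
move=> x.
have ci : {for x, continuous (fun y : 'rV[R]_n.+1 => y ord0 ord0)}.
  exact: coord_continuous.
have cc : {for x, continuous (f \o (fun y : 'rV[R]_n.+1 => y ord0 ord0))}.
  apply: continuous_comp; [exact: ci|exact: cf].
exact: cc.
Qed.

Lemma weight_bounded i : exists M : R,
  forall x, Omega x -> `|weight f x i| <= M.
Proof.
have [r r0 Or] := bounded_subset_ball bO.
have cB : compact (`[- r, r]%classic : set R) by exact: segment_compact.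
have [M Mf] : exists M : R, forall t, `|t| <= r -> `|f t| <= M.
  have := compact_bounded (continuous_compact (continuous_subspaceT cf) cB).
  move=> [M [_ fM]]; exists (M + 1) => t; rewrite ler_norml => tr.
  by apply: fM; [rewrite ltrDl|exists t => //=; rewrite in_itv].
exists (Num.max M 1) => x Ox; rewrite /weight; case: ifPn => _.
  rewrite le_max Mf//; apply: (le_trans (rV_coord_le_norm _ _)).
  by have := Or _ Ox; rewrite -ball_normE /ball_/= sub0r normrN => /ltW.
by rewrite normr1 le_max lexx orbT.
Qed.

(** The weight of the [i]-th derivative is constant along the [i]-th
    direction. *)
Lemma weight_shift x (i : 'I_n.+1) (t : R) :
  weight f (x + t *: delta_mx ord0 i) i = weight f x i.
Proof.
have /negbTE o0 : (ord0 : 'I_n.+1) != ord_max.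
  by rewrite -val_eqE/= eq_sym -lt0n.
rewrite /weight; case: eqP => // ->; congr f.
by rewrite !mxE o0 andbF mulr0 addr0.
Qed.

Lemma ae_weight_gt0 (f0 : forall t, t != 0 -> 0 < f t) :
  {ae mu, forall x : 'rV[R]_n.+1, forall i, 0 < weight f x i}.
Proof.
apply: negligibleS (negligible_hyperplane ord0 (0 : R)) => x /= nx.
apply: contrapT => /eqP x0; apply: nx => i; rewrite /weight.
by case: ifP => // _; exact: f0.
Qed.

(** Almost everywhere, the weak derivatives are limits of one-sided difference
    quotients, from both sides. *)
Lemma Wf_quotient_cvg v G (i : 'I_n.+1) (s : R) : Wf_gradient f Omega v G ->
  s * s = 1 ->
  {ae mu, forall x, Omega x ->
    k.+1%:R * (weight f x i *
        (v (x + k.+1%:R^-1 *: (s *: delta_mx ord0 i)) - v x))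
      @[k --> \oo] --> s * G x ord0 i}.
Proof.
move=> [L2v L2G wG] ss; set d := s *: _.
have [V [mV iV _ V0 vV]] := L2_representative L2v.
have [H [mH iH _ H0 GH]] := L2_representative (L2G i).
have [M aM] := weight_bounded i.
(* The weight is carried by the function: [W = a V] has the unweighted weak
   derivative [H]. *)
pose a x := weight f x i; pose W x := a x * V x.
have ma : measurable_fun setT a.
  by apply: continuous_measurable_rV; exact: continuous_weight.
have iW : mu.-integrable setT (EFin \o W).
  apply: (le_integrable _ _ _ (integrableZl measurableT M iV)) => //.
    by apply/measurable_EFinP; exact: measurable_funM.
  move=> x _; rewrite /= lee_fin !normrM.
  have [Ox|Ox] := pselect (Omega x); last by rewrite V0// normr0 !mulr0.
  by rewrite ler_wpM2r// (le_trans (aM _ Ox))// ler_norm.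
have weak phi : test_function Omega phi ->
    \int[mu]_x (W x * partial i phi x) = - \int[mu]_x (H x * phi x).
  move=> tphi.
  transitivity (\int[mu]_(x in Omega) (v x * (weight f x i * partial i phi x))).
    rewrite [RHS]Rintegral_mkcond; apply: eq_Rintegral_ae.
    apply: filterS vV => x vVx _; rewrite patchE; case: ifPn => [|].
      by rewrite inE => /vVx ->; rewrite /W /a mulrCA mulrA.
    by rewrite notin_setE => /V0 V0x; rewrite /W V0x mulr0 mul0r.
  rewrite wG//; congr (- _); rewrite Rintegral_mkcond; apply: eq_Rintegral_ae.
  apply: filterS GH => x GHx _; rewrite patchE; case: ifPn => [|].
    by rewrite inE => /GHx ->.
  by rewrite notin_setE => /H0 ->; rewrite mul0r.
have vVk : {ae mu, forall x, forall k : nat, Omega (x + k.+1%:R^-1 *: d) ->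
    v (x + k.+1%:R^-1 *: d) = V (x + k.+1%:R^-1 *: d)}.
  apply: ae_foralln => k; exact: (ae_translation (k.+1%:R^-1 *: d) vV).
have Q := weak_quotient_cvg oO iW iH weak ss.
apply: filterS (filterI (filterI Q vV) (filterI vVk GH)).
move=> x [[+ vVx] [vVxk GHx]] Ox => /(_ Ox); rewrite GHx//.
apply: cvg_trans; apply: near_eq_cvg; near=> k.
rewrite vVx// vVxk//; last first.
  by near: k; have := @cvg_shift_harmonic R n x d; apply; exact: open_nbhs_nbhs.
rewrite /W /a /d scalerA weight_shift; congr (_ * _); ring.
Unshelve. all: by end_near. Qed.

End degenerate_sobolev.

(** * The Poincare inequality *)

Section poincare.
Context (R : realType) (n : nat).
Local Notation mu := (lebesgue_rV R n.+1).
Implicit Types (phi g : 'rV[R]_n.+1 -> R).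

Lemma lipschitz_bound phi : lipschitz phi ->
  exists2 L : R, 0 <= L & forall x y, `|phi x - phi y| <= L * `|x - y|.
Proof.
move=> [M [_ ML]]; exists (`|M| + 1); first exact: addr_ge0.
have MM : M < `|M| + 1 by rewrite (le_lt_trans (ler_norm M))// ltrDl.
by move=> x y; have := ML _ MM (x, y); apply.
Qed.

Lemma lipschitz_continuous phi (L : R) : 0 <= L ->
  (forall x y, `|phi x - phi y| <= L * `|x - y|) -> continuous phi.
Proof.
move=> L0 phiL x; apply/(@cvgrPdist_lt _ _ _ (nbhs x) (nbhs_filter x)) => e e0.
have e1 : 0 < e / (L + 1) by rewrite divr_gt0// ltr_wpDl.
apply/nbhs_ballP; exists (e / (L + 1)) => //= y.
rewrite -ball_normE /ball_/= => xy; apply: le_lt_trans (phiL x y) _.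
apply: (@le_lt_trans _ _ ((L + 1) * `|x - y|)).
  by rewrite ler_wpM2r// lerDl.
by rewrite mulrC -ltr_pdivlMr// ltr_wpDl.
Qed.

Lemma integrable_on_ball (r C : R) (g : 'rV[R]_n.+1 -> R) :
  measurable_fun setT g -> (forall x, `|g x| <= C * \1_(ball 0 r) x) ->
  mu.-integrable setT (EFin \o g).
Proof.
move=> mg gC; have mb := measurable_rV_ball (0 : 'rV[R]_n.+1) r.
have i1 : mu.-integrable setT (EFin \o (\1_(ball 0 r) : 'rV[R]_n.+1 -> R)).
  apply/integrableP; split; first by apply/measurable_EFinP; exact: measurable_indic.
  rewrite (eq_integral (fun x : 'rV[R]_n.+1 => (\1_(ball 0 r) x)%:E)); last first.
    by move=> x _; rewrite /= ger0_norm.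
  by rewrite integral_indic// setIT; exact: lebesgue_rV_ball_lty.
apply: (le_integrable _ _ _ (integrableZl measurableT C i1)) => //.
  exact/measurable_EFinP.
by move=> x _; rewrite /= lee_fin (le_trans (gC x))// ler_norm.
Qed.

(** The Poincare inequality in the first direction, obtained from a discrete
    integration by parts against the first coordinate. *)
Lemma poincare_lipschitz (Omega : set 'rV[R]_n.+1) (r : R) phi g :
  open Omega -> bounded_set Omega -> 0 < r ->
  Omega `<=` ball (0 : 'rV[R]_n.+1) r ->
  lipschitz phi -> compact_support_in Omega phi -> L2 Omega g ->
  {ae mu, forall x, Omega x ->
    k.+1%:R * (phi (x + k.+1%:R^-1 *: ((1 : R) *: delta_mx ord0 ord0)) - phi x)
      @[k --> \oo] --> g x} ->
  (\int[mu]_(x in Omega) ((phi x) ^+ 2)%:E <=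
   (4 * r ^+ 2)%:E * \int[mu]_(x in Omega) ((g x) ^+ 2)%:E)%E.
Proof.
move=> oO bO r0 Or /lipschitz_bound[L L0 phiL] [cK KO] L2g cvg_g.
set d := (1 : R) *: _ in cvg_g.
have [G [mG iG iG2 G0 gG]] := L2_representative oO bO L2g.
have cphi : continuous phi := lipschitz_continuous L0 phiL.
have mphi : measurable_fun setT phi by exact: continuous_measurable_rV.
set K := closure _ in cK KO.
have phiK x : ~ K x -> phi x = 0.
  move=> nK; apply/eqP; apply: contrapT => /negP phix; apply: nK.
  exact: subset_closure.
have [B phiB] : exists B, forall x, `|phi x| <= B.
  have [M [_ phiM]] := compact_bounded (continuous_compact (continuous_subspaceT cphi) cK).
  exists (`|M| + 1) => x; have [Kx|/phiK ->] := pselect (K x); last first.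
    by rewrite normr0 addr_ge0.
  apply: phiM; last by exists x.
  by rewrite (le_lt_trans (ler_norm M))// ltrDl.
have B0 : 0 <= B by apply: le_trans (phiB 0).
have phir x : r <= `|x| -> phi x = 0.
  move=> rx; apply: phiK => /KO/Or; rewrite -ball_normE /ball_/= sub0r normrN.
  by rewrite ltNge rx.
pose h (k : nat) : R := k.+1%:R^-1.
have h0 k : 0 < h k by rewrite invr_gt0 ltr0n.
have h1 k : h k <= 1 by rewrite invf_le1 ?ltr0n// ler1n.
have d1 : `|d| <= 1.
  rewrite /d scale1r; apply: norm_le_rV_coord => // i; rewrite mxE eqxx/=.
  by case: eqP; rewrite ?normr1 ?normr0.
have hd k : `|h k *: d| <= h k by rewrite normrZ gtr0_norm// ler_piMr// ltW.
pose D k x := k.+1%:R * (phi (x + h k *: d) - phi x).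
have DL k x : `|D k x| <= L.
  rewrite /D normrM ger0_norm ?ler0n// mulrC -ler_pdivlMr ?ltr0n//.
  apply: le_trans (phiL _ _) _; rewrite addrAC subrr add0r.
  by rewrite ler_wpM2l.
have mphih k : measurable_fun setT (fun x : 'rV[R]_n.+1 => phi (x + h k *: d)).
  by apply: measurableT_comp => //; exact: measurable_translation.
have mD k : measurable_fun setT (D k).
  by apply: measurable_funM => //; exact: measurable_funB.
(* Outside [Omega] the quotients vanish eventually, the support of [phi] being
   closed and contained in [Omega]. *)
have cvD : {ae mu, forall x, D k x @[k --> \oo] --> G x}.
  apply: filterS2 cvg_g gG => x gx Gx; have [Ox|nOx] := pselect (Omega x).
    by rewrite -Gx//; exact: gx.
  rewrite G0//; have nKx : (~` K) x by move=> /KO.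
  have oK : open (~` K) by apply: closed_openC; exact: closed_closure.
  have : x + h k *: d @[k --> \oo] --> x by exact: cvg_shift_harmonic.
  move=> /(_ _ (open_nbhs_nbhs (conj oK nKx))) nKx'.
  have nK : \forall k \near \oo, ~ K (x + h k *: d) by exact: nKx'.
  apply: cvg_near_cst; apply: filterS nK => k /= nKk.
  by rewrite /D phiK// phiK// subrr mulr0.
pose c0 (x : 'rV[R]_n.+1) : R := x ord0 ord0.
have mc : measurable_fun setT c0.
  by apply: continuous_measurable_rV; exact: coord_continuous.
have cr x : `|c0 x| <= `|x| by exact: rV_coord_le_norm.
have br x : `|x| < r + 1 -> \1_(ball (0 : 'rV[R]_n.+1) (r + 1)) x = 1 :> R.
  by move=> xr; rewrite indicE mem_set// -ball_normE /ball_/= sub0r normrN.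
have Nbr x : 0 <= \1_(ball (0 : 'rV[R]_n.+1) (r + 1)) x :> R by rewrite indicE.
pose T k x := c0 x * ((phi (x + h k *: d) + phi x) * D k x).
have mT k : measurable_fun setT (T k).
  apply: measurable_funM => //; apply: measurable_funM => //.
  exact: measurable_funD.
have Tdom k x : `|T k x| <= (r + 1) * (2 * B * L) * \1_(ball (0 : 'rV[R]_n.+1) (r + 1)) x.
  have [xr|xr] := ltP `|x| (r + 1).
    rewrite br// mulr1 normrM ler_pM//; first by rewrite (le_trans (cr x))// ltW.
    rewrite normrM ler_pM// (le_trans (ler_normD _ _))//.
    by rewrite mulr2n mulrDl mul1r lerD.
  have x1 : phi x = 0 by apply: phir; apply: le_trans xr; rewrite lerDl.
  have x2 : phi (x + h k *: d) = 0.
    apply: phir; have := ler_normB (x + h k *: d) (h k *: d); rewrite addrK.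
    by move: (hd k) (h1 k) xr; lra.
  by rewrite /T x1 x2 addr0 mul0r mulr0 normr0 mulr_ge0// !mulr_ge0// addr_ge0// ltW.
have phi2dom (v : 'rV[R]_n.+1 -> R) (C : R) : 0 <= C ->
    (forall x, `|x| < r + 1 -> `|v x| <= C) -> forall x,
    `|v x * phi x ^+ 2| <= C * B ^+ 2 * \1_(ball (0 : 'rV[R]_n.+1) (r + 1)) x.
  move=> C0 vC x; have [xr|xr] := ltP `|x| (r + 1).
    rewrite br// mulr1 normrM ler_pM//; first exact: vC.
    by rewrite normrX ler_pXn2r ?nnegrE.
  have -> : phi x = 0 by apply: phir; apply: le_trans xr; rewrite lerDl.
  by rewrite expr0n/= mulr0 normr0 mulr_ge0// mulr_ge0// sqr_ge0.
have mphi2 : measurable_fun setT (fun x => phi x ^+ 2) by exact: measurable_funX.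
have r1 : 0 <= r + 1 by rewrite addr_ge0// ltW.
have iphi2 : mu.-integrable setT (EFin \o (fun x => phi x ^+ 2)).
  apply: (@integrable_on_ball (r + 1) (1 * B ^+ 2)) => // x.
  have := phi2dom (cst 1) 1 ler01 (fun x _ => ltac:(by rewrite normr1)) x.
  by rewrite /= mul1r.
have icphi2 : mu.-integrable setT (EFin \o (fun x => c0 x * phi x ^+ 2)).
  apply: (@integrable_on_ball (r + 1) ((r + 1) * B ^+ 2)).
    exact: measurable_funM.
  by apply: phi2dom => // x xr; rewrite (le_trans (cr x))// ltW.
(* Translating by [h k], the integral of [x_0 (phi (x + h d) ^ 2 - phi x ^ 2) / h]
   is that of [((x_0 - h) - x_0) / h phi ^ 2 = - phi ^ 2]. *)
have TE k : \int[mu]_x T k x = - \int[mu]_x (phi x ^+ 2).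
  pose S x := (c0 x - h k) * phi x ^+ 2.
  have iS : mu.-integrable setT (EFin \o S).
    have := integrableB measurableT icphi2 (integrableZl measurableT (h k) iphi2).
    by apply: eq_integrable => // x _ /=; rewrite /S mulrBl.
  have iSh : mu.-integrable setT (EFin \o (fun x : 'rV[R]_n.+1 => S (x + h k *: d))).
    exact: (integrable_translation (h k *: d) iS).
  transitivity (\int[mu]_x (k.+1%:R * (S (x + h k *: d) - c0 x * phi x ^+ 2))).
    apply: eq_Rintegral => x _; rewrite /S /T /D /c0 !mxE !eqxx/= !mulr1 addrK; ring.
  rewrite RintegralZl//; last exact: (integrableB measurableT iSh icphi2).
  rewrite RintegralB//.
  have -> : \int[mu]_x S (x + h k *: d) = \int[mu]_x S x.
    by rewrite /Rintegral; congr fine; exact: (integral_translation (h k *: d) iS).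
  rewrite -RintegralB// (_ : \int[mu]_x _ = \int[mu]_x (- h k * phi x ^+ 2)); last first.
    by apply: eq_Rintegral => x _; rewrite /S; ring.
  have kh : k.+1%:R * h k = 1 by rewrite /h divff// pnatr_eq0.
  by rewrite RintegralZl// mulNr mulrN mulrA kh mul1r.
have cvT : \int[mu]_x T k x @[k --> \oo] --> \int[mu]_x (2 * (c0 x * phi x * G x)).
  apply: (@Rintegral_dominated_cvg _ _ _ mu _ _
    (fun x => (r + 1) * (2 * B * L) * \1_(ball (0 : 'rV[R]_n.+1) (r + 1)) x)) => //.
  - apply: measurable_funM => //; apply: measurable_funM => //.
    exact: measurable_funM.
  - apply: filterS cvD => x Dx.
    rewrite (_ : 2 * _ = c0 x * ((phi x + phi x) * G x)); last by ring.
    apply: cvgM; first exact: cvg_cst.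
    apply: cvgM => //; apply: cvgD; last exact: cvg_cst.
    have : x + h k *: d @[k --> \oo] --> x by exact: cvg_shift_harmonic.
    by move=> xk; apply: continuous_cvg xk; exact: cphi.
  - apply: (@integrable_on_ball (r + 1) ((r + 1) * (2 * B * L))).
      by apply: measurable_funM => //; apply: measurable_indic; exact: measurable_rV_ball.
    by move=> x; rewrite ger0_norm// !mulr_ge0.
  - by apply: aeW => x k; exact: Tdom.
have limE : \int[mu]_x (2 * (c0 x * phi x * G x)) = - \int[mu]_x (phi x ^+ 2).
  apply/esym; apply: (cvg_unique _ _ cvT) => //.
  rewrite (_ : (fun k => _) = cst (- \int[mu]_x (phi x ^+ 2))); first exact: cvg_cst.
  by apply/funext => k; exact: TE.
(* Young's inequality; half of the integral of [phi ^ 2] is then absorbed in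
   the left-hand side. *)
have young x : - (2 * (c0 x * phi x * G x)) <=
    2^-1 * phi x ^+ 2 + 2 * r ^+ 2 * G x ^+ 2.
  have [Ox|Ox] := pselect (Omega x); last first.
    rewrite G0// mulr0 mulr0 oppr0 expr0n/= mulr0 addr0 mulr_ge0//.
    by rewrite sqr_ge0.
  have xr : `|c0 x| <= r.
    apply: (le_trans (cr x)); have := Or _ Ox.
    by rewrite -ball_normE /ball_/= sub0r normrN => /ltW.
  have c2 : c0 x ^+ 2 <= r ^+ 2 by rewrite -real_normK ?num_real// ler_pXn2r ?nnegrE// ltW.
  have : c0 x ^+ 2 * G x ^+ 2 <= r ^+ 2 * G x ^+ 2 by rewrite ler_wpM2r// sqr_ge0.
  have := sqr_ge0 (phi x + 2 * c0 x * G x).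
  rewrite !expr2; nra.
have icpG : mu.-integrable setT (EFin \o (fun x => 2 * (c0 x * phi x * G x))).
  have iBG := integrableZl measurableT ((r + 1) * (2 * B)) iG.
  apply: (le_integrable _ _ _ iBG) => //.
    apply/measurable_EFinP; apply: measurable_funM => //.
    by apply: measurable_funM => //; exact: measurable_funM.
  move=> x _; rewrite /= lee_fin.
  have cp : `|c0 x * phi x| <= (r + 1) * B.
    rewrite normrM; have [xr|xr] := ltP `|x| (r + 1).
      by rewrite ler_pM// (le_trans (cr x))// ltW.
    have -> : phi x = 0 by apply: phir; apply: le_trans xr; rewrite lerDl.
    by rewrite normr0 mulr0 mulr_ge0.
  rewrite mulrA [leLHS]normrM [leRHS]normrM ler_wpM2r//.
  rewrite normrM [`|2|]ger0_norm// [leRHS]ger0_norm ?mulr_ge0//.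
  by rewrite mulrCA ler_wpM2l.
have iY : mu.-integrable setT
    (EFin \o (fun x => 2^-1 * phi x ^+ 2 + 2 * r ^+ 2 * G x ^+ 2)).
  have := integrableD measurableT (integrableZl measurableT (2^-1) iphi2)
    (integrableZl measurableT (2 * r ^+ 2) iG2).
  exact: eq_integrable.
set I := \int[mu]_x (phi x ^+ 2) in limE.
pose J := \int[mu]_x (G x ^+ 2).
have IJ : I <= 4 * r ^+ 2 * J.
  have : I <= \int[mu]_x (2^-1 * phi x ^+ 2 + 2 * r ^+ 2 * G x ^+ 2).
    rewrite -[I]opprK -limE -mulN1r -RintegralZl//.
    apply: le_Rintegral => //.
      exact: (integrableZl measurableT (-1) icpG).
    by move=> x _; rewrite mulN1r; exact: young.
  rewrite RintegralD//; last 2 first.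
  - exact: (integrableZl measurableT (2^-1) iphi2).
  - exact: (integrableZl measurableT (2 * r ^+ 2) iG2).
  by rewrite !RintegralZl// -/I -/J; lra.
have -> : (\int[mu]_(x in Omega) ((phi x) ^+ 2)%:E = I%:E)%E.
  rewrite /I /Rintegral fineK; last exact: (integrable_fin_num measurableT iphi2).
  rewrite [LHS]integral_mkcond; apply: eq_integral => x _; rewrite patchE.
  by case: ifPn => //; rewrite notin_setE => nOx; rewrite phiK ?expr0n// => /KO.
have -> : (\int[mu]_(x in Omega) ((g x) ^+ 2)%:E = J%:E)%E.
  rewrite /J /Rintegral fineK; last exact: (integrable_fin_num measurableT iG2).
  rewrite [LHS]integral_mkcond; apply: eq_integral_ae.
  apply: filterS gG => x gG _; rewrite patchE; case: ifPn.
    by rewrite inE => /gG ->.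
  by rewrite notin_setE => /G0 ->; rewrite expr0n.
by rewrite -EFinM lee_fin.
Qed.

End poincare.

(** * Positive parts, quadratic forms and energies *)

Section difference_quotient_limits.
Context (R : realType).
Implicit Types (U : nat -> R) (a b c l p : R).

(** Convergent difference quotients force the values to converge. *)
Lemma quotient_cvg_cvg U a c p : 0 < a ->
  k.+1%:R * (a * (U k - c)) @[k --> \oo] --> p -> U k @[k --> \oo] --> c.
Proof.
move=> a0 Up.
have : a^-1 * (k.+1%:R^-1 * (k.+1%:R * (a * (U k - c)))) + c @[k --> \oo] -->
    a^-1 * (0 * p) + c.
  apply: cvgD; last exact: cvg_cst.
  apply: cvgM; first exact: cvg_cst.
  by apply: cvgM => //; exact: cvg_harmonic.
rewrite mul0r mulr0 add0r; apply: cvg_trans; apply: near_eq_cvg; apply: nearW => k.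
have : k.+1%:R != 0 :> R by rewrite pnatr_eq0.
move: (k.+1%:R : R) => K K0 /=.
by field; rewrite K0 gt_eqF.
Qed.

(** The derivative of a positive part, read off the difference quotients from
    both sides: where [u = l] the quotients of [(u - l)^+] are nonnegative on
    one side and nonpositive on the other. *)
Lemma positive_part_quotient (Up Um : nat -> R) a c l (g gw : R) : 0 < a ->
  k.+1%:R * (a * (Up k - c)) @[k --> \oo] --> 1 * g ->
  k.+1%:R * (a * (Num.max (Up k - l) 0 - Num.max (c - l) 0)) @[k --> \oo] -->
    1 * gw ->
  k.+1%:R * (a * (Num.max (Um k - l) 0 - Num.max (c - l) 0)) @[k --> \oo] -->
    -1 * gw ->
  gw = if l < c then g else 0.
Proof.
move=> a0 Ug wp wm; have Uc := quotient_cvg_cvg a0 Ug.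
rewrite mul1r in Ug; rewrite mul1r in wp; rewrite mulN1r in wm.
case: ltgtP => [lc|cl|lc].
- rewrite -(cvg_lim _ wp)//; apply: cvg_lim => //; apply: cvg_trans Ug; apply: near_eq_cvg.
  near=> k; have lU : l < Up k by near: k; exact: (cvgr_gt c).
  by rewrite !max_l ?subr_ge0 ?ltW//; congr (_ * (_ * _)); ring.
- rewrite -(cvg_lim _ wp)//; apply: cvg_lim => //; apply: cvg_near_cst.
  near=> k; have lU : Up k < l by near: k; exact: (cvgr_lt c).
  by rewrite !max_r ?subr_le0 ?ltW// subrr !mulr0.
- rewrite lc subrr maxxx in wp wm; apply/eqP; rewrite eq_le.
  have nneg (U : nat -> R) k : 0 <= k.+1%:R * (a * (Num.max (U k - c) 0 - 0)).
    rewrite subr0; apply: mulr_ge0 => //; apply: mulr_ge0; first exact: ltW.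
    by rewrite le_max lexx orbT.
  apply/andP; split.
    by rewrite -oppr_ge0; apply: (cvgr_to_ge wm); apply: nearW => k; exact: nneg.
  by apply: (cvgr_to_ge wp); apply: nearW => k; exact: nneg.
Unshelve. all: by end_near. Qed.

End difference_quotient_limits.

Section quadratic_forms.
Context (R : realType) (n : nat).
Implicit Types (f : R -> R) (G : 'rV[R]_n.+1 -> 'rV[R]_n.+1) (x : 'rV[R]_n.+1).

(** Where the weights do not vanish, the form of [D_f] on the full gradient is
    the squared norm of the degenerate gradient. *)
Lemma mxform_Dmat_full_gradient f G x : (forall i, 0 < weight f x i) ->
  mxform (Dmat f x) (full_gradient f G x) (full_gradient f G x) =
  \sum_i G x ord0 i ^+ 2.
Proof.
move=> w0; rewrite /mxform !mxE; apply: eq_bigr => i _.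
rewrite /Dmat mul_mx_diag !mxE.
have := w0 i; rewrite /weight; case: ifP => _ wi.
  by field; rewrite gt_eqF.
by rewrite divr1 mulr1 expr2.
Qed.

Lemma full_gradient_eq f G G' x : (forall i, G x ord0 i = G' x ord0 i) ->
  full_gradient f G x = full_gradient f G' x.
Proof. by move=> GG; apply/rowP => i; rewrite !mxE GG. Qed.

Lemma full_gradient0 f G x : (forall i, G x ord0 i = 0) ->
  full_gradient f G x = 0.
Proof. by move=> G0; apply/rowP => i; rewrite !mxE G0 mul0r. Qed.

End quadratic_forms.

Section energy.
Context (R : realType) (n : nat).
Local Notation mu := (lebesgue_rV R n.+1).
Variables (Omega : set 'rV[R]_n.+1).
Hypothesis oO : open Omega.
Hypothesis bO : bounded_set Omega.

Let mO : measurable Omega. Proof. exact: open_measurable_rV. Qed.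

Lemma L2_sum_lty (c : R) (g : 'I_n.+1 -> 'rV[R]_n.+1 -> R) : 0 <= c ->
  (forall i, L2 Omega (g i)) ->
  (\int[mu]_(x in Omega) (c * \sum_i g i x ^+ 2)%:E < +oo)%E.
Proof.
move=> c0 L2g; have /choice[H HP] := fun i => L2_representative oO bO (L2g i).
have iH : mu.-integrable setT (EFin \o (fun x => \sum_i H i x ^+ 2)).
  have iHi i : mu.-integrable setT (fun x => (H i x ^+ 2)%:E) by case: (HP i).
  have := integrable_sum measurableT (index_enum 'I_n.+1) (P := xpredT)
    (fun i _ => iHi i).
  by apply: eq_integrable => // x _; rewrite /= sumEFin.
have /integrableP[_] := integrableS measurableT mO (@subsetT _ _)
  (integrableZl measurableT c iH).
apply: le_lt_trans; apply: ge0_le_integral_ae => [x _|x _|].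
- rewrite lee_fin mulr_ge0//; apply: sumr_ge0 => i _; exact: sqr_ge0.
- by [].
- have : {ae mu, forall x, forall i, Omega x -> g i x = H i x}.
    have gHi i : {ae mu, forall x, Omega x -> g i x = H i x} by case: (HP i).
    apply: negligibleS (negligible_bigcup_countable gHi) => x /= /existsNP[i nx].
    by exists i.
  apply: filterS => x gH Ox; rewrite lee_fin; apply: le_trans (ler_norm _).
  by rewrite ler_wpM2l//; apply: ler_sum => i _; rewrite gH.
Qed.

Lemma L2_eq0 (c : R) v : 0 < c -> L2 Omega v ->
  (\int[mu]_(x in Omega) (c * (v x) ^+ 2)%:E <= 0)%E ->
  {ae mu, forall x, Omega x -> v x = 0}.
Proof.
move=> c0 /(L2_representative oO bO)[V [mV _ iV2 V0 vV]] v0.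
have cV (t : R) : 0 <= c * t ^+ 2 by rewrite mulr_ge0 ?sqr_ge0// ltW.
have mV2 : measurable_fun Omega (fun x => (c * V x ^+ 2)%:E).
  apply: (measurable_funS measurableT (@subsetT _ _)).
  by apply/measurable_EFinP; apply: measurable_funM => //; exact: measurable_funX.
have VV : (\int[mu]_(x in Omega) `|(c * V x ^+ 2)%:E| = 0)%E.
  apply/eqP; rewrite eq_le integral_ge0// andbT; apply: le_trans v0.
  apply: ge0_le_integral_ae => [x _|x _|]; [by []|by rewrite lee_fin|].
  by apply: filterS vV => x + Ox => -> //; rewrite /= ger0_norm.
have := (ae_eq_integral_abs mu mO mV2).1 VV.
apply: filterS2 vV => x vx V2 Ox; have := V2 Ox; rewrite vx//= => -[].
by move=> /eqP; rewrite mulf_eq0 gt_eqF//= expf_eq0/= => /eqP.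
Qed.

End energy.

(** * Gradients of positive parts and the vanishing lemma *)

Section maximum_principle.
Context (R : realType) (n : nat).
Local Notation mu := (lebesgue_rV R n.+1).
Variables (Omega : set 'rV[R]_n.+1) (f : R -> R).
Hypothesis oO : open Omega.
Hypothesis bO : bounded_set Omega.
Hypothesis cf : continuous f.
Hypothesis f0 : forall t, t != 0 -> 0 < f t.
Hypothesis n0 : (0 < n)%N.

Let mO : measurable Omega. Proof. exact: open_measurable_rV. Qed.

(** The weak gradient of [(u - l)^+] is the gradient of [u] where [u > l], and
    zero elsewhere. *)
Lemma positive_part_gradient u Gu Gw (l : R) : Wf_gradient f Omega u Gu ->
  Wf_gradient f Omega (fun x => Num.max (u x - l) 0) Gw ->
  {ae mu, forall x, Omega x -> forall i,
    Gw x ord0 i = if l < u x then Gu x ord0 i else 0}.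
Proof.
move=> uGu wGw.
have comp i : {ae mu, forall x, Omega x ->
    Gw x ord0 i = if l < u x then Gu x ord0 i else 0}.
  have Nss : (-1) * (-1) = 1 :> R by rewrite mulrNN mul1r.
  have Qu := Wf_quotient_cvg oO bO cf n0 i uGu (mul1r 1).
  have Qp := Wf_quotient_cvg oO bO cf n0 i wGw (mul1r 1).
  have Qm := Wf_quotient_cvg oO bO cf n0 i wGw Nss.
  have wgt := @ae_weight_gt0 R n f f0.
  apply: filterS (filterI (filterI Qu wgt) (filterI Qp Qm)).
  move=> x [[Qux wx] [Qpx Qmx]] Ox.
  exact: (positive_part_quotient (wx i) (Qux Ox) (Qpx Ox) (Qmx Ox)).
apply: negligibleS (negligible_bigcup_countable comp) => x /= /not_implyP[Ox].
by move=> /existsNP[i ni]; exists i => // /(_ Ox).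
Qed.

Lemma energy_finite v G : Wf_gradient f Omega v G ->
  (\int[mu]_(x in Omega)
     (`|v x| ^+ 2 + \sum_i G x ord0 i ^+ 2)%:E < +oo)%E.
Proof.
move=> [L2v L2G _]; have [V [mV iV iV2 V0 vV]] := L2_representative oO bO L2v.
have /choice[H HP] := fun i => L2_representative oO bO (L2G i).
have iHi i : mu.-integrable setT (fun x => (H i x ^+ 2)%:E) by case: (HP i).
have iH := integrableD measurableT iV2
  (integrable_sum measurableT (index_enum 'I_n.+1) (P := xpredT)
    (fun i _ => iHi i)).
have /integrableP[_] := integrableS measurableT mO (@subsetT _ _) iH.
apply: le_lt_trans; apply: ge0_le_integral_ae => [x _|x _|].
- by rewrite lee_fin addr_ge0// sumr_ge0// => i _; rewrite sqr_ge0.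
- by [].
have GHi i : {ae mu, forall x, Omega x -> G x ord0 i = H i x} by case: (HP i).
have GH : {ae mu, forall x, forall i, Omega x -> G x ord0 i = H i x}.
  apply: negligibleS (negligible_bigcup_countable GHi) => x /= /existsNP[i nx].
  by exists i.
apply: filterS2 vV GH => x vVx GHx Ox; rewrite /= sumEFin vVx//.
rewrite lee_fin -[V x ^+ 2]real_normK ?num_real//.
apply: le_trans (ler_norm _); rewrite lerD2l.
by apply: ler_sum => i _; rewrite GHx.
Qed.

(** A function of [(W_f^{1,2})_0] whose first derivative vanishes is zero: the
    first direction is not degenerate. *)
Lemma Wf0_eq0 w Gw : Wf0 f Omega w -> Wf_gradient f Omega w Gw ->
  {ae mu, forall x, Omega x -> Gw x ord0 ord0 = 0} ->
  {ae mu, forall x, Omega x -> w x = 0}.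
Proof.
move=> [_ approx] wGw Gw0; have [L2w _ _] := wGw.
have [r r0 Or] := bounded_subset_ball bO.
have w1 x : weight f x (ord0 : 'I_n.+1) = 1.
  by rewrite /weight -val_eqE/= eq_sym (gtn_eqF n0).
apply: (L2_eq0 oO bO ltr01) => //; under eq_integral do rewrite mul1r.
(* Let [phi] be an approximation with error [eps] and [G] the gradient of
   [w - phi]. The first derivative of [phi] is [- G_0], whose norm is at most
   [eps]; the Poincare inequality makes [phi] small, hence also [w]. *)
have small (eps : R) : 0 < eps ->
    (\int[mu]_(x in Omega) ((w x) ^+ 2)%:E <=
     (2 * (4 * r ^+ 2 + 1) * eps ^+ 2)%:E)%E.
  move=> eps0; have [phi [lphi cphi [G wphiG normG]]] := approx _ eps0.
  have [L2d L2G _] := wphiG.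
  have en := energy_finite wphiG.
  have en2 : (\int[mu]_(x in Omega)
      (`|(w \- phi) x| ^+ 2 + \sum_i G x ord0 i ^+ 2)%:E <= (eps ^+ 2)%:E)%E.
    move: normG; rewrite /Wf_norm => normG.
    set E := (X in (X <= _)%E).
    have E0 : (0 <= E)%E.
      apply: integral_ge0 => x _.
      by rewrite lee_fin addr_ge0// sumr_ge0// => i _; rewrite sqr_ge0.
    have fE : E \is a fin_num by rewrite ge0_fin_numE.
    rewrite -(fineK fE) lee_fin.
    have e2 : 0 <= fine E by rewrite fine_ge0.
    rewrite -(sqr_sqrtr e2) ler_pXn2r ?nnegrE ?sqrtr_ge0 ?(ltW eps0)//.
    exact: ltW.
  have d2 : (\int[mu]_(x in Omega) (((w \- phi) x) ^+ 2)%:E <= (eps ^+ 2)%:E)%E.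
    apply: le_trans en2; apply: ge0_le_integral_ae => [x _|x _|].
    - by rewrite lee_fin sqr_ge0.
    - by rewrite lee_fin addr_ge0// sumr_ge0// => i _; rewrite sqr_ge0.
    - apply: aeW => x _; rewrite lee_fin real_normK ?num_real// lerDl.
      by rewrite sumr_ge0// => i _; rewrite sqr_ge0.
  have g2 : (\int[mu]_(x in Omega) ((- G x ord0 ord0) ^+ 2)%:E <= (eps ^+ 2)%:E)%E.
    apply: le_trans en2; apply: ge0_le_integral_ae => [x _|x _|].
    - by rewrite lee_fin sqr_ge0.
    - by rewrite lee_fin addr_ge0// sumr_ge0// => i _; rewrite sqr_ge0.
    - apply: aeW => x _; rewrite lee_fin sqrrN (bigD1 ord0)//= addrCA lerDl.
      by rewrite addr_ge0// sumr_ge0// => i _; rewrite sqr_ge0.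
  have L2g : L2 Omega (fun x => - G x ord0 ord0).
    split; last by apply: le_lt_trans g2 _; rewrite ltry.
    have [[h mh Gh] _] := L2G ord0; exists (fun x => - h x).
      exact: measurableT_comp.
    by apply: filterS Gh => x + Ox => ->.
  have Qw := Wf_quotient_cvg oO bO cf n0 ord0 wGw (mul1r 1).
  have Qd := Wf_quotient_cvg oO bO cf n0 ord0 wphiG (mul1r 1).
  have Qphi : {ae mu, forall x, Omega x ->
      k.+1%:R * (phi (x + k.+1%:R^-1 *: ((1 : R) *: delta_mx ord0 ord0)) - phi x)
        @[k --> \oo] --> - G x ord0 ord0}.
    apply: filterS (filterI (filterI Qw Qd) Gw0) => x [[Qwx Qdx] Gwx] Ox.
    set d := (1 : R) *: _ in Qwx Qdx *.
    have -> : - G x ord0 ord0 = 1 * Gw x ord0 ord0 - 1 * G x ord0 ord0.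
      by rewrite Gwx// mulr0 sub0r mul1r.
    rewrite (_ : (fun k => _) =
        (fun k => k.+1%:R * (weight f x ord0 * (w (x + k.+1%:R^-1 *: d) - w x))) \-
        (fun k => k.+1%:R * (weight f x ord0 *
          ((w \- phi) (x + k.+1%:R^-1 *: d) - (w \- phi) x)))).
      by apply: cvgB; [exact: Qwx|exact: Qdx].
    by apply/funext => k /=; rewrite w1; ring.
  have poin := poincare_lipschitz oO bO r0 Or lphi cphi L2g Qphi.
  have phi2 : (\int[mu]_(x in Omega) ((phi x) ^+ 2)%:E <=
      (4 * r ^+ 2 * eps ^+ 2)%:E)%E.
    apply: le_trans poin _; rewrite [leRHS]EFinM lee_wpmul2l// lee_fin mulr_ge0//.
    exact: sqr_ge0.
  have [L L0 phiL] := lipschitz_bound lphi.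
  have mphi : measurable_fun Omega phi.
    apply: (measurable_funS measurableT (@subsetT _ _)).
    exact: continuous_measurable_rV (lipschitz_continuous L0 phiL).
  have [V [mV _ _ _ vV]] := L2_representative oO bO L2d.
  have mVO : measurable_fun Omega V.
    exact: (measurable_funS measurableT (@subsetT _ _)).
  apply: (@le_trans _ _ (\int[mu]_(x in Omega)
      ((2 * phi x ^+ 2)%:E + (2 * V x ^+ 2)%:E))%E).
    apply: ge0_le_integral_ae => [x _|x _|].
    - by rewrite lee_fin sqr_ge0.
    - by rewrite -EFinD lee_fin addr_ge0// mulr_ge0// sqr_ge0.
    - apply: filterS vV => x vVx Ox; rewrite -EFinD lee_fin -vVx//=.
      have := sqr_ge0 (phi x - (w x - phi x)).
      rewrite -subr_ge0 [X in _ -> 0 <= X](_ : _ = (phi x - (w x - phi x)) ^+ 2)//.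
      by ring.
  rewrite ge0_integralD//; last 4 first.
  - by move=> x _; rewrite lee_fin mulr_ge0// sqr_ge0.
  - apply/measurable_EFinP; apply: measurable_funM => //; exact: measurable_funX.
  - by move=> x _; rewrite lee_fin mulr_ge0// sqr_ge0.
  - apply/measurable_EFinP; apply: measurable_funM => //; exact: measurable_funX.
  have two (v : 'rV[R]_n.+1 -> R) : measurable_fun Omega v ->
      (\int[mu]_(x in Omega) (2 * v x ^+ 2)%:E =
       2%:E * \int[mu]_(x in Omega) (v x ^+ 2)%:E)%E.
    move=> mv; under eq_integral do rewrite EFinM.
    rewrite ge0_integralZl//.
    - by apply/measurable_EFinP; exact: measurable_funX.
    - by move=> x _; rewrite lee_fin sqr_ge0.
  rewrite !two//.
  have <- : (\int[mu]_(x in Omega) (((w \- phi) x) ^+ 2)%:E =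
      \int[mu]_(x in Omega) (V x ^+ 2)%:E)%E.
    by apply: eq_integral_ae; apply: filterS vV => x + Ox => ->.
  rewrite [leRHS](_ : _ =
      (2%:E * (4 * r ^+ 2 * eps ^+ 2)%R%:E + 2%:E * (eps ^+ 2)%R%:E)%E); last first.
    by rewrite -!EFinM -EFinD; congr EFin; ring.
  by apply: leeD; apply: lee_wpmul2l.
rewrite leNgt; apply/negP => I0.
have fI : (\int[mu]_(x in Omega) ((w x) ^+ 2)%:E)%E \is a fin_num.
  by rewrite ge0_fin_numE ?(ltW I0)//; case: L2w.
move: I0 small; rewrite -(fineK fI); set I := fine _; rewrite lte_fin => I0 small.
pose C := 2 * (4 * r ^+ 2 + 1).
have C0 : 0 < C by rewrite mulr_gt0// ltr_wpDl// mulr_ge0// sqr_ge0.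
(* For [eps ^ 2 = I / (2 C)] the bound reads [I <= I / 2]. *)
have e0 : 0 < Num.sqrt (I / (2 * C)) by rewrite sqrtr_gt0 divr_gt0// mulr_gt0.
have := small _ e0; rewrite -/C lee_fin sqr_sqrtr; last first.
  by rewrite divr_ge0 ?(ltW I0)// mulr_ge0// ltW.
rewrite (_ : C * (I / (2 * C)) = I / 2); last by field; rewrite gt_eqF.
by move: I0; lra.
Qed.

End maximum_principle.

(** * The maximum principle *)

Theorem theorem2 (R : realType) (n : nat) (n_ge2 : (2 <= n.+1)%N)
  (Omega : set 'rV[R]_n.+1)
  (Omega_open : open Omega) (Omega_connected : connected Omega)
  (Omega_nonempty : Omega !=set0) (Omega_bounded : bounded_set Omega)
  (f F : R -> R) (r0 : R)
  (f_degeneracy : degeneracy f) (r0_gt0 : 0 < r0)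
  (fF : {in `]0, r0[, forall t, f t = expR (- F t)})
  (F_geometry : structured_geometry r0 F)
  (A : 'rV[R]_n.+1 -> R -> 'M[R]_n.+1) (u : 'rV[R]_n.+1 -> R)
  (A_admissible : admissible_coefficients A Omega u)
  (A_Dmat : comparable_Dmat A f Omega)
  (u_Wf : Wf f Omega u)
  (u_subsolution : weak_subsolution A f Omega (fun=> 0) u)
  (u_boundary : exists l, boundary_bounded_by f Omega u l) :
  (ess_sup_in Omega u <= boundary_sup f Omega u)%E.
Proof.
have n0 : (0 < n)%N by [].
have [cf _ _ _ f0] := f_degeneracy.
have [c [C [c0 cC ACD]]] := A_Dmat.
have [Gu uGu] := u_Wf.
rewrite /boundary_sup; apply: le_ereal_inf_tmp => _ [l w0 <-].
(* The positive part of [u - l] is an admissible test function. *)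
pose w x := Num.max (u x - l) 0.
have [[Gw wGw] _] := w0.
have w_ge0 : {ae lebesgue_rV R n.+1, forall x, Omega x -> 0 <= w x}.
  by apply: aeW => x _; rewrite le_max lexx orbT.
have sub := u_subsolution.2 Gu w Gw uGu w0 wGw w_ge0.
pose Q x := mxform (A x (u x)) (full_gradient f Gw x) (full_gradient f Gu x).
(* [Q] is the form of the coefficients on the gradient of [w], hence lies
   between multiples of squared norms of degenerate gradients. *)
have QE : {ae lebesgue_rV R n.+1, forall x, Omega x ->
    c * Gw x ord0 ord0 ^+ 2 <= Q x <= C * \sum_i Gu x ord0 i ^+ 2}.
  have Gwu := positive_part_gradient Omega_open Omega_bounded cf f0 n0 uGu wGw.
  have wgt := @ae_weight_gt0 R n f f0.
  apply: filterS (filterI (filterI Gwu wgt) ACD) => x [[Gwux wx] Ax] Ox.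
  have Gu2 : 0 <= \sum_i Gu x ord0 i ^+ 2.
    by apply: sumr_ge0 => i _; exact: sqr_ge0.
  have [lu|lu] := ltP l (u x).
    have Gi i : Gw x ord0 i = Gu x ord0 i by rewrite Gwux// lu.
    have /andP[A1 A2] := Ax Ox (u x) (full_gradient f Gu x).
    rewrite /Q (full_gradient_eq _ Gi).
    rewrite !mxform_Dmat_full_gradient// in A1 A2.
    rewrite A2 andbT; apply: le_trans A1; rewrite ler_wpM2l ?(ltW c0)//.
    by rewrite Gi (bigD1 ord0)//= lerDl; apply: sumr_ge0 => i _; exact: sqr_ge0.
  have Gi i : Gw x ord0 i = 0 by rewrite Gwux// ltNge lu.
  rewrite /Q (full_gradient0 _ Gi) /mxform !mul0mx mxE Gi expr0n/= mulr0 lexx/=.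
  by rewrite mulr_ge0// (le_trans _ cC)// ltW.
(* [q] is a nonnegative version of [Q]; its integral is finite, so that the
   real-valued integral in the hypothesis is not a default value. *)
pose q x := Num.max (Q x) 0.
have q0 x : 0 <= q x by rewrite le_max lexx orbT.
have Qq : {ae lebesgue_rV R n.+1, forall x, Omega x -> Q x = q x}.
  apply: filterS QE => x QEx Ox; have /andP[Q1 _] := QEx Ox.
  by rewrite /q max_l// (le_trans _ Q1)// mulr_ge0 ?sqr_ge0// ltW.
have [_ L2Gu _] := uGu; have [_ L2Gw _] := wGw.
have qoo : (\int[lebesgue_rV R n.+1]_(x in Omega) (q x)%:E < +oo)%E.
  have := L2_sum_lty Omega_open Omega_bounded (le_trans (ltW c0) cC) L2Gu.
  apply: le_lt_trans; apply: ge0_le_integral_ae => [x _|x _|].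
  - by rewrite lee_fin.
  - rewrite lee_fin mulr_ge0//; first exact: le_trans (ltW c0) cC.
    by apply: sumr_ge0 => i _; exact: sqr_ge0.
  - apply: filterS2 QE Qq => x QEx Qqx Ox.
    by rewrite lee_fin -Qqx//; have /andP[] := QEx Ox.
have q_le0 : (\int[lebesgue_rV R n.+1]_(x in Omega) (q x)%:E <= 0)%E.
  have qge : (0 <= \int[lebesgue_rV R n.+1]_(x in Omega) (q x)%:E)%E.
    by apply: integral_ge0 => x _; rewrite lee_fin.
  rewrite -(fineK (x := \int[_]_(_ in _) _)%E) ?ge0_fin_numE// lee_fin.
  have : 0 <= - \int[lebesgue_rV R n.+1]_(x in Omega) Q x.
    apply: le_trans sub; rewrite (eq_Rintegral _ (g := cst 0)).
      by rewrite /Rintegral integral0.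
    by move=> x _; rewrite mul0r.
  by rewrite (eq_Rintegral_ae Qq) oppr_ge0.
have Gw0 : {ae lebesgue_rV R n.+1, forall x, Omega x -> Gw x ord0 ord0 = 0}.
  apply: (L2_eq0 Omega_open Omega_bounded c0 (L2Gw ord0)).
  apply: le_trans q_le0; apply: ge0_le_integral_ae => [x _|x _|].
  - by rewrite lee_fin mulr_ge0 ?sqr_ge0// ltW.
  - by rewrite lee_fin.
  - apply: filterS2 QE Qq => x QEx Qqx Ox.
    by rewrite lee_fin -Qqx//; have /andP[] := QEx Ox.
have wE := Wf0_eq0 Omega_open Omega_bounded cf n0 w0 wGw Gw0.
rewrite /ess_sup_in /ess_sup; apply: ereal_inf_lbound => /=.
apply: filterS wE => x wx; rewrite /patch; case: ifPn => [|_]; last exact: leNye.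
rewrite inE => Ox /=; rewrite lee_fin -subr_le0.
by rewrite -(wx Ox) /w le_max lexx.
Qed.
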